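(* Let $X=\mathbb{R}^d$ with the metric of an $\ell_p$-norm, $p\ge1$, let $r>0$, $\gamma>0$, $\mathcal{U}(x)=\mathcal{B}_r(x)$, $\mathcal{V}(x)=\mathcal{B}_{(1+\gamma)r}(x)$, and let $\mathcal{H}\subseteq\{0,1\}^X$ be a hypothesis class of finite VC-dimension. Let $C\subseteq X$ be a countable $r\gamma$-cover of $X$, with induced perturbation type $\mathcal{C}(x)=\mathcal{V}(x)\cap C$, such that $|\mathcal{C}(x)|\le\left(1+\frac{(1+\gamma)d}{\gamma}\right)^d$ for all $x\in X$ (for instance the regular grid of side length $2r\gamma/d$). Then the realizable semi-supervised algorithm described in the context is a $\gamma$-tolerant adversarially robust learner for $\mathcal{H}$ in the realizable semi-supervised setting, with unlabeled sample complexity $$m_u=\tilde{O}\left(\frac{\mathrm{VC}(\mathcal{H})\,d\,(\log(1+1/\gamma)+\log d)+\log(1/\delta)}{\epsilon}\right)$$ and labeled sample complexity $$m_l=\tilde{O}\left(\frac{\mathrm{VC}_{\mathcal{V}}(\mathcal{H})\log m_u+\log(1/\delta)}{\epsilon^2}\right).$$ That is, there are such functions $m_u(\epsilon,\delta),m_l(\epsilon,\delta)$ so that for all $\epsilon,\delta\in(0,1)$ and every distribution $P$ over $X\times\{0,1\}$ with $\mathcal{L}^{\mathcal{V}}_P(\mathcal{H})=0$, when $S_l$ consists of $m_l(\epsilon,\delta)$ i.i.d. labeled examples from $P$ and $S_u$ consists of $m_u(\epsilon,\delta)$ i.i.d. unlabeled examples from the marginal $P_X$ (independent of $S_l$), the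 output $f$ of the algorithm satisfies $\mathcal{L}^{\mathcal{U}}_P(f)\le\epsilon$ with probability at least $1-\delta$.
   Context: Setting. A hypothesis is a function $h:X\to\{0,1\}$ and a hypothesis class $\mathcal{H}$ is a nonempty set of hypotheses. All hypotheses and loss sets are assumed measurable. A perturbation type is a map $\mathcal{U}:X\to 2^X$. $\mathcal{B}_\rho(x)=\{z\in X:\mathrm{dist}(x,z)\le\rho\}$. A set $C\subseteq X$ is an $r\gamma$-cover of $X$ if for all $x\in X$ there is $c\in C$ with $\mathrm{dist}(x,c)\le r\gamma$. Adversarial loss. For $(x,y)\in X\times\{0,1\}$, $\ell^{\mathcal{U}}(h,x,y)=\max_{z\in\mathcal{U}(x)}\mathbf{1}[h(z)\ne y]$. For a distribution $P$, $\mathcal{L}^{\mathcal{U}}_P(h)=\mathbb{E}_{(x,y)\sim P}\,\ell^{\mathcal{U}}(h,x,y)$ and $\mathcal{L}^{\mathcal{U}}_P(\mathcal{H})=\inf_{h\in\mathcal{H}}\mathcal{L}^{\mathcal{U}}_P(h)$; for a finite labeled sample $S$ of size $n$, $\mathcal{L}^{\mathcal{U}}_S(h)=\frac1n\sum_{i=1}^n\ell^{\mathcal{U}}(h,x_i,y_i)$. An RERM oracle $\mathcal{A}^{\mathcal{V}}_{\mathcal{H}}$ maps a labeled sample $S$ to an arbitrary element of $\arg\min_{h\in\mathcal{H}}\mathcal{L}^{\mathcal{V}}_S(h)$. $\mathrm{VC}_{\mathcal{V}}$-dimension. $\mathcal{H}$ $\mathcal{V}$-shatters $K\subseteq X$ if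 for every labeling $y\in\{0,1\}^K$ there is $h\in\mathcal{H}$ with $h(z)=y(x)$ for all $x\in K$ and all $z\in\mathcal{V}(x)$. $\mathrm{VC}_{\mathcal{V}}(\mathcal{H})$ is the supremum of the sizes of sets $\mathcal{V}$-shattered by $\mathcal{H}$. Algorithm (semi-supervised, realizable). Input: labeled data $S_l$, unlabeled data $S_u=(x_1,\dots,x_n)$, an RERM oracle $\mathcal{A}^{\mathcal{V}}_{\mathcal{H}}$, and the cover $C$. 1. Start with $\mathcal{H}'=\emptyset$. For each labeling $y=(y_1,\dots,y_n)\in\{0,1\}^n$, form $S_u^y=((x_1,y_1),\dots,(x_n,y_n))$ and $h'=\mathcal{A}^{\mathcal{V}}_{\mathcal{H}}(S_u^y)$; if $\mathcal{L}^{\mathcal{V}}_{S_u^y}(h')=0$, add $h'$ to $\mathcal{H}'$. 2. Let $\hat h$ be an arbitrary element of $\arg\min_{h\in\mathcal{H}'}\mathcal{L}^{\mathcal{C}}_{S_l}(h)$. 3. Output $\mathrm{nn}_C(\hat h)$, defined by $\mathrm{nn}_C(\hat h)(x)=\hat h(x')$ where $x'$ is a nearest neighbour of $x$ in $C$ (ties broken arbitrarily). Conventions. In asymptotic bounds, $\log t$ is read as $\max\{1,\log t\}$, and $\tilde{O}(g)$ means at most $c\,g\,(\log Q)^c$ for a universal constant $c$, where $Q$ is the largest of the quantities appearing in $g$ (including $m_u$ where it appears). *)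

(* Defs.v *)
From HB Require Import structures.
From mathcomp Require Import all_boot all_order all_algebra finmap.
From mathcomp Require Import all_classical all_reals all_analysis.

Set Implicit Arguments.
Unset Strict Implicit.
Unset Printing Implicit Defensive.

Import Order.TTheory GRing.Theory Num.Theory.

Local Open Scope classical_set_scope.
Local Open Scope ring_scope.

(** Labels are [bool] ([false] for 0, [true] for 1), a hypothesis is a map
    [X -> bool], a perturbation type is a map [X -> set X], and a labelled
    sample of size [n] is an [n.-tuple (X * bool)].  The instance space [R^d] is
    [d.-tuple R] with the sigma-algebra generated by the coordinates, i.e. the
    Borel sigma-algebra. *)

(** The exponent may be infinite; the value for [-oo] is irrelevant. *)
Definition lp_norm {R : realType} (d : nat) (p : \bar R) (v : 'I_d -> R) : R :=
  match p with
  | q%:E => (\sum_i `|v i| `^ q) `^ q^-1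
  | +oo%E => \big[Num.max/0]_i `|v i|
  | -oo%E => 0
  end.

Definition lp_dist {R : realType} (d : nat) (p : \bar R) (x z : d.-tuple R) : R :=
  lp_norm p (fun i => tnth x i - tnth z i).

Definition dist_ball {R : realType} {X : Type} (dist : X -> X -> R) (rho : R)
  (x : X) : set X := [set z | dist x z <= rho].

Definition is_cover {R : realType} {X : Type} (dist : X -> X -> R) (rho : R)
  (C : set X) : Prop := forall x, exists2 c, C c & dist x c <= rho.

Definition nearest {R : realType} {X : Type} (dist : X -> X -> R) (C : set X)
  (x x' : X) : Prop := C x' /\ forall c, C c -> dist x x' <= dist x c.

Definition argmin {R : realType} {T : Type} (A : set T) (f : T -> R) : set T :=
  [set a | A a /\ forall b, A b -> f a <= f b].

(** The supremum of a nonempty set of values in {0, 1} is their maximum. *)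
Definition adv_loss {R : realType} {X : Type} (U : X -> set X) (h : X -> bool)
  (x : X) (y : bool) : R := sup [set (h z != y)%:R | z in U x].

Definition emp_risk {R : realType} {X : Type} (U : X -> set X) (h : X -> bool)
  (n : nat) (S : n.-tuple (X * bool)) : R :=
  n%:R^-1 * \sum_(i < n) adv_loss U h (tnth S i).1 (tnth S i).2.

Definition adv_risk {R : realType} {dX : measure_display} {X : measurableType dX}
  (P : probability (X * bool)%type R) (U : X -> set X) (h : X -> bool) : \bar R :=
  ('E_P[fun z => adv_loss U h z.1 z.2])%E.

Definition class_adv_risk {R : realType} {dX : measure_display}
  {X : measurableType dX} (P : probability (X * bool)%type R) (U : X -> set X)
  (H : set (X -> bool)) : \bar R := ereal_inf [set adv_risk P U h | h in H].

Definition hypothesis_class (R : realType) {dX : measure_display}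
  {X : measurableType dX} (V : X -> set X) (H : set (X -> bool)) : Prop :=
  H !=set0 /\
  forall h, H h ->
    measurable_fun [set: X] h /\
    measurable [set z : X * bool | adv_loss V h z.1 z.2 = 1 :> R].

Definition shatters {X : choiceType} (V : X -> set X) (H : set (X -> bool))
  (K : {fset X}) : Prop :=
  forall y : X -> bool, exists2 h, H h &
    forall x, x \in K -> forall z, V x z -> h z = y x.

Definition robust_vc_dim (R : realType) {X : choiceType} (V : X -> set X)
  (H : set (X -> bool)) : \bar R :=
  ereal_sup [set (#|` K|%:R)%:E | K in [set K | shatters V H K]].

(** With [V x = {x}] shattering is the classical notion. *)
Definition vc_dim (R : realType) {X : choiceType} (H : set (X -> bool)) : \bar R :=
  robust_vc_dim R (fun x => [set x]) H.

Definition oracle (X : Type) := forall n, n.-tuple (X * bool) -> (X -> bool).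

Definition rerm (R : realType) {X : Type} (V : X -> set X) (H : set (X -> bool))
  (A : oracle X) : Prop :=
  forall n (S : n.-tuple (X * bool)),
    argmin H (fun h => emp_risk V h S : R) (A n S).

Definition candidates (R : realType) {X : Type} (V : X -> set X) (A : oracle X)
  (n : nat) (Su : n.-tuple X) : set (X -> bool) :=
  [set h | exists2 y : n.-tuple bool,
     h = A n [tuple of zip Su y] & emp_risk V h [tuple of zip Su y] = 0 :> R].

(** [f x] may use any nearest neighbour of [x] in [C]; the choice may depend
    on everything else. *)
Definition ss_output {R : realType} {X : Type} (dist : X -> X -> R)
  (V : X -> set X) (C : set X) (A : oracle X) (nl nu : nat)
  (Sl : nl.-tuple (X * bool)) (Su : nu.-tuple X) (f : X -> bool) : Prop :=
  exists2 h, argmin (candidates R V A Su)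
                    (fun h => emp_risk (fun x => V x `&` C) h Sl : R) h &
             forall x, exists2 x', nearest dist C x x' & f x = h x'.

Definition ss_learner (X : Type) :=
  forall nl nu, nl.-tuple (X * bool) -> nu.-tuple X -> (X -> bool).

(** The algorithm with all its ties resolved.  When the set of candidates is
    empty its second step is undefined, and the output is unconstrained. *)
Definition ss_algorithm {R : realType} {X : Type} (dist : X -> X -> R)
  (V : X -> set X) (C : set X) (A : oracle X) (alg : ss_learner X) : Prop :=
  forall nl nu (Sl : nl.-tuple (X * bool)) (Su : nu.-tuple X),
    candidates R V A Su !=set0 -> ss_output dist V C A Sl Su (alg nl nu Sl Su).

Definition cons_pair {T : Type} (n : nat) (x : T * n.-tuple T) : n.+1.-tuple T :=
  [the n.+1.-tuple T of x.1 :: x.2].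

Lemma measurable_cons_pair d (T : measurableType d) n :
  measurable_fun [set: T * n.-tuple T] (@cons_pair T n).
Proof. exact: measurable_cons. Qed.

HB.instance Definition _ d (T : measurableType d) n :=
  isMeasurableFun.Build _ _ _ _ (@cons_pair T n) (@measurable_cons_pair d T n).

(** The law of [n] independent draws from [P]. *)
Fixpoint iid {R : realType} {d : measure_display} {T : measurableType d}
    (P : probability T R) (n : nat) : probability (n.-tuple T) R :=
  match n with
  | 0 => \d_ [tuple]
  | m.+1 => distribution (P \x iid P m)%E (@cons_pair T m)
  end.

Lemma iid_rect {R : realType} {d : measure_display} {T : measurableType d}
    (P : probability T R) (n : nat) (A : 'I_n -> set T) :
  (forall i, measurable (A i)) ->
  iid P n [set t | forall i, A i (tnth t i)] = (\prod_(i < n) P (A i))%E.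
Proof.
elim: n A => [|n IH] A mA.
  rewrite big_ord0 /= diracE mem_set//=.
  by case.
rewrite big_ord_recl -IH => [|i]; last exact: mA.
rewrite /= /distribution /pushforward -product_measure1E//.
  congr (_ _); apply/seteqP; split => -[x t] /=.
    move=> At; split; first by have := At ord0; rewrite (tnth_nth x).
    by move=> i; have := At (lift ord0 i); rewrite tnthS.
  move=> [Ax At] i; case: (unliftP ord0 i) => [j ->|->].
    by rewrite tnthS; exact: At.
  by rewrite (tnth_nth x).
rewrite (_ : mkset _ = \bigcap_(i in setT) ((@tnth n T)^~ i @^-1` A (lift ord0 i))).
  apply: fin_bigcap_measurable => // i _.
  by rewrite -[X in measurable X]setTI; exact: measurable_tnth.
by apply/seteqP; split => t /= h i; [move=> _; exact: h | exact: (h i I)].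
Qed.

Definition fst_rv {d d' : measure_display} {T : measurableType d}
  {T' : measurableType d'} : T * T' -> T := fst.

HB.instance Definition _ d d' (T : measurableType d) (T' : measurableType d') :=
  isMeasurableFun.Build _ _ _ _ (@fst_rv d d' T T') measurable_fst.

Definition marginal {R : realType} {dX : measure_display} {X : measurableType dX}
  (P : probability (X * bool)%type R) : probability X R :=
  distribution P fst_rv.

(** An oracle with arbitrary tie-breaking may depend on the sample in a
    non-measurable way, so that the success set need not be an event; as
    hypotheses and loss sets are taken to be measurable, so is the success
    set. *)
Definition tolerant_robust_ss_learner {R : realType} {dX : measure_display}
  {X : measurableType dX} (U V : X -> set X) (H : set (X -> bool))
  (alg : ss_learner X) (mu ml : R -> R -> nat) : Prop :=
  forall eps delta : R, 0 < eps < 1 -> 0 < delta < 1 ->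
  forall P : probability (X * bool)%type R, class_adv_risk P V H = 0%E ->
  let success :=
    [set S : (ml eps delta).-tuple (X * bool) * (mu eps delta).-tuple X |
       (adv_risk P U (alg _ _ S.1 S.2) <= eps%:E)%E] in
  measurable success ->
  ((1 - delta)%:E <=
     (iid P (ml eps delta) \x iid (marginal P) (mu eps delta)) success)%E.

(** In bounds [log t] is read as [max {1, log t}]. *)
Definition log1 {R : realType} (t : R) : R := Num.max 1 (ln t).

(** [m] is at most [c * g * (log Q) ^ c], where [Q] is the largest of the
    quantities [qs]. *)
Definition soft_bigO {R : realType} (c g : R) (qs : seq R) (m : nat) : Prop :=
  m%:R <= c * g * (log1 (\big[Num.max/0]_(q <- qs) q)) `^ c.

(* Main.v *)
(** Write [LC h] for the set of labelled points on which [h] incurs the loss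
    [l^C], and [LV h] for the loss [l^V].

    Unlabelled phase.  Pretend that the sample [Su] carries its true labels.
    Some [h0] in [H] has such a small V-risk that, with high probability, it
    has no V-loss on that sample; hence the oracle returns, on that labelling, a
    candidate without V-loss, a fortiori without C-loss.  Since [l^C] is a
    maximum over at most [k] points, on [2n] points the sets [LC h] cut out at
    most [(2nk + 1)^VC] traces, and the double-sample argument of Vapnik and
    Chervonenkis shows that every such hypothesis has C-risk at most [eps / 16].

    Labelled phase.  By Sauer's lemma for V-shattering there are at most
    [(n + 1)^VC_V] candidates.  Chernoff bounds and a union bound show that a
    candidate of minimal empirical C-loss has C-risk at most [eps].

    Finally, if [z] is within [r] of [x], the nearest neighbour of [z] in the
    cover is in [V x], so the U-loss of [nn_C h] is at most the C-loss of [h].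

    Uncountable suprema over [H] and the arbitrary oracle raise measurability
    problems.  As [C] is countable, [l^C] factors through a measurable map to
    [nat], and all sets of tuples of natural numbers are measurable. *)

Require Import Defs.
From HB Require Import structures.
From mathcomp Require Import all_boot all_order all_algebra finmap.
From mathcomp Require Import all_classical all_reals all_analysis.
From mathcomp Require Import measurable_realfun ring lra.

Set Implicit Arguments.
Unset Strict Implicit.
Unset Printing Implicit Defensive.

Import Order.TTheory GRing.Theory Num.Theory.

Local Open Scope classical_set_scope.
Local Open Scope ring_scope.

(** * Sauer's lemma for robust shattering *)

(** A set of coordinates is encoded by its indicator word [m], so that its size is [count id m];
    this is classical shattering of that set by a family of binary words. *)
Definition mask_shattered n (F : pred (n.-tuple bool)) (m : n.-tuple bool) :=
  forall y : n.-tuple bool,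
    exists2 t, F t & forall i, tnth m i -> tnth t i = tnth y i.

Lemma card_tuple_cons n (F : pred (n.+1.-tuple bool)) :
  (#|F| = #|[pred t : n.-tuple bool | F (cons_tuple true t)]|
        + #|[pred t : n.-tuple bool | F (cons_tuple false t)]|)%N.
Proof.
pose c b (t : n.-tuple bool) := cons_tuple b t.
have inj b : injective (c b) by move=> s t /(congr1 val)[] /val_inj.
have memc b b' u (Q : pred (n.-tuple bool)) :
    (c b' u \in image_mem (c b) (mem Q)) = (b == b') && Q u.
  apply/fintype.imageP/andP => [[w Qw e]|[/eqP <- Qu]]; last by exists u.
  have e1 : b' = b by move/(congr1 val) : e => [].
  by move: e; rewrite e1 => /inj ->; rewrite eqxx.
rewrite -(fintype.card_image (inj true)) -(fintype.card_image (inj false)) -cardUI.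
rewrite [X in (_ + X)%N]eq_card0 ?addn0 => [|t]; last first.
  rewrite inE; apply/negP => /andP[/fintype.imageP[u _ ->]].
  by rewrite memc.
apply: eq_card => t; rewrite !inE.
have -> : t = c (thead t) (behead_tuple t).
  by rewrite {1}(tuple_eta t); exact: val_inj.
by rewrite !memc; case: (thead t); rewrite /= ?orbF.
Qed.

(** Induction on the length, splitting the words by their first bit. With [G] the union and [K] the
    intersection of the two halves, [#|F| = #|G| + #|K|]. A mask shattered by [G] is shattered by
    [F]; one shattered by [K] stays so after the first coordinate is added to it, so [K] satisfies
    the hypothesis with [v - 1]. *)
Lemma sauer n v (F : pred (n.-tuple bool)) :
  (forall m, mask_shattered F m -> count id m <= v)%N -> (#|F| <= n.+1 ^ v)%N.
Proof.
elim: n v F => [|n IH] v F Fv.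
  by rewrite exp1n (leq_trans (max_card _))// card_tuple expn0.
rewrite card_tuple_cons -cardUI; set G := [predU _ & _]; set K := [predI _ & _].
have Gv : (#|G| <= n.+1 ^ v)%N.
  apply: IH => m Gm; have := Fv (cons_tuple false m); rewrite /= add0n; apply => y.
  have [t Gt tm] := Gm (behead_tuple y).
  have h b : F (cons_tuple b t) -> exists2 t0, F t0 &
      forall i, tnth (cons_tuple false m) i -> tnth t0 i = tnth y i.
    move=> Fbt; exists (cons_tuple b t) => // i.
    case: (unliftP ord0 i) => [j ->|->]; last by rewrite (tnth_nth false).
    rewrite !tnthS => /tm ->; rewrite !(tnth_nth false)/= nth_behead.
    by rewrite /bump leq0n add1n.
  by move: Gt; rewrite /G /= => /orP[]; exact: h.
have Kv m : mask_shattered K m -> (count id m < v)%N.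
  move=> Km; have := Fv (cons_tuple true m); rewrite /= add1n; apply => y.
  have [t /andP[/= Ft Ff] tm] := Km (behead_tuple y).
  exists (cons_tuple (thead y) t).
    by case: (thead y).
  move=> i; case: (unliftP ord0 i) => [j ->|-> _].
    rewrite !tnthS => /tm ->; rewrite !(tnth_nth false)/= nth_behead.
    by rewrite /bump leq0n add1n.
  by rewrite (tnth_nth false)/=.
case: v => [|v] in Fv Gv Kv *.
  (* A member of [K] would make [K] shatter the empty mask, whose size is not below 0. *)
  suff -> : #|K| = 0%N by rewrite addn0.
  apply: eq_card0 => t; apply/negP => Kt.
  suff /Kv : mask_shattered K [tuple of nseq n false] by rewrite ltn0.
  move=> y; exists t => // i; by rewrite (tnth_nth false)/= nth_nseq if_same.
have K1 : (#|K| <= n.+1 ^ v)%N by apply: IH => m /Kv.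
rewrite (leq_trans (leq_add Gv K1))// expnSr -{2}[(n.+1 ^ v)%N]muln1 -mulnDr addn1.
rewrite expnSr leq_mul2r; apply/orP; right.
case: (v) => [|w]; [by rewrite !expn0 | by rewrite leq_exp2r].
Qed.

(** The robustly realised labellings form a family of words, and a mask shattered by this family
    marks a [V]-shattered set of as many points, so [sauer] applies. *)
Lemma card_robust_patterns (X : choiceType) (V : X -> set X)
    (H : set (X -> bool)) (v n : nat) (x : n.-tuple X) :
  (forall z, V z z) -> (forall K, shatters V H K -> #|` K| <= v)%N ->
  (#|[pred y : n.-tuple bool | `[< exists2 h, H h &
      forall i z, V (tnth x i) z -> h z = tnth y i >]]| <= n.+1 ^ v)%N.
Proof.
move=> Vxx HK; apply: sauer => m mF.
have real_m (y : X -> bool) : exists2 h, H h &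
    forall i, tnth m i -> forall z, V (tnth x i) z -> h z = y (tnth x i).
  have [t /asboolP[h Hh ht] tm] := mF [tuple y (tnth x i) | i < n].
  by exists h => // i mi z Vz; rewrite (ht i z Vz) tm// tnth_mktuple.
(* Marked indices carrying the same point always receive the same label, whereas the word [i == k]
   separates them; so repetitions in [x] cannot be marked twice. *)
have inj : {in [pred i | tnth m i] &, injective (tnth x)}.
  move=> i j /[!inE] mi mj xij; apply: contrapT => /eqP ij.
  have [t /asboolP[h Hh ht] tm] := mF [tuple i == k | k < n].
  have := tm _ mi; have := tm _ mj.
  rewrite -(ht i (tnth x i))// -(ht j (tnth x j))// -xij !tnth_mktuple eqxx.
  by move=> -> /esym/eqP; rewrite (negbTE ij).
pose K := [fset tnth x i | i in [pred i | tnth m i]]%fset.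
have <- : #|` K| = count id m.
  rewrite card_in_imfset/=; last first.
  by move=> i j mi mj; apply: inj.
  rewrite -sum1_count big_tuple -cardE -sum1_card.
  by apply: eq_bigl => i.
apply: HK => y; have [h Hh hy] := real_m y; exists h => //.
by move=> _ /imfsetP[i /= mi ->] z; apply: hy.
Qed.

(** * Numerical estimates *)

Section numerics.
Context {R : realType}.
Implicit Types t : R.

Lemma log1_ge1 t : 1 <= log1 t. Proof. by rewrite /log1 le_max lexx. Qed.

Lemma ln_le_log1 t : ln t <= log1 t.
Proof. by rewrite /log1 le_max lexx orbT. Qed.

Lemma ln_leB1 t : 0 < t -> ln t <= t - 1.
Proof.
move=> t0; have := @le_ln1Dx R (t - 1).
by rewrite addrCA subrr addr0 => -> //; lra.
Qed.

Lemma log1_le_self t : 1 <= t -> log1 t <= t.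
Proof.
move=> t1; rewrite /log1 ge_max t1.
by rewrite (le_trans (ln_leB1 (lt_le_trans ltr01 t1)))// gerBl.
Qed.

Lemma expR_half_le2 : expR 2^-1 <= 2 :> R.
Proof.
rewrite -[leLHS]invrK -expRN invf_ple ?posrE ?expR_gt0//.
by rewrite (le_trans _ (expR_ge1Dx _))//; lra.
Qed.

Lemma two_le_expR1 : 2 <= expR 1 :> R.
Proof. by have := @expR_ge1Dx R 1; lra. Qed.

Lemma powX_le_expR (x y : R) (v : nat) (a : R) :
  1 <= x -> x <= expR y -> v%:R <= a -> x ^+ v <= expR (a * y).
Proof.
move=> x1 xy va; have x0 : 0 < x by lra.
have y0 : 0 <= y.
  by rewrite -ler_expR expR0 (le_trans x1).
rewrite (@le_trans _ _ (expR y ^+ v))//.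
  by rewrite lerXn2r ?nnegrE ?expR_ge0// ltW.
by rewrite -expRM_natl ler_expR ler_wpM2r.
Qed.

(** The power [2 ^+ k0] has to beat the growth polynomial. Since [expR 2^-1 <= 2], twice this power
    is at least [expR (eps * n / 128)], whose exponent is at least [16 * (a * D + ld) * L]; the
    polynomial is at most [expR (a * (14 + 7 * L + 2 * D))]. *)
Lemma unlabelled_size (a D ld eps delta L : R) (n v k : nat) :
  0 < eps < 1 -> 0 < delta -> v%:R <= a -> 2 <= D -> 1 <= L -> 1 <= ld ->
  ln delta^-1 <= ld -> k%:R <= expR (2 * D) -> n%:R <= expR (12 + 7 * L) ->
  32 * 64 * (a * D + ld) * L <= eps * n%:R ->
  let k0 := Num.truncn (eps / 16 * n%:R / 4) in
  [/\ k0%:R <= eps / 16 * n%:R / 4, 4 <= eps / 16 * n%:R, (k0 <= n)%N &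
      2 * (((n + n) * k).+1 ^ v)%:R / 2 ^+ k0 <= delta / 4].
Proof.
move=> /andP[eps0 eps1] delta0 va D2 L1 ld1 lnd kD nL Kn k0.
have a0 : 0 <= a by rewrite (le_trans _ va).
have aD0 : 0 <= a * D by rewrite mulr_ge0//; lra.
have aDL0 : 0 <= a * D * L by rewrite mulr_ge0//; lra.
have ldL : ld <= ld * L by rewrite ler_peMr//; lra.
have en : 32 * 64 <= eps * n%:R by lra.
have k0le : k0%:R <= eps / 16 * n%:R / 4.
  by rewrite truncn_le; lra.
have n1 : 1 <= n%:R :> R.
  have : eps * n%:R <= n%:R by rewrite ler_piMl// ltW.
  by lra.
split => //.
- lra.
- have : eps * n%:R <= n%:R by rewrite ler_piMl// ltW.
  by rewrite -(ler_nat R); lra.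
set x : R := (((n + n) * k).+1)%:R.
have x1 : 1 <= x by rewrite ler1n.
(* Here [2nk + 1 <= 3 * n * expR (2 * D)] and [3 <= expR 2]. *)
have xe : x <= expR (2 + (12 + 7 * L) + 2 * D).
  apply: (@le_trans _ _ (3 * n%:R * expR (2 * D))).
    have E1 : 1 <= expR (2 * D) by rewrite -[leLHS]expR0 ler_expR; lra.
    rewrite /x -natr1 natrM natrD.
    have nk : n%:R * k%:R <= n%:R * expR (2 * D) by rewrite ler_wpM2l.
    have : 1 * 1 <= n%:R * expR (2 * D) by rewrite ler_pM.
    by lra.
  rewrite 2!expRD ler_wpM2r ?expR_ge0// ler_pM//.
  by have := @expR_ge1Dx R 2; lra.
rewrite natrX -/x.
have xv := powX_le_expR x1 xe va.
have tk : expR (eps * n%:R / 128) <= 2 * 2 ^+ k0.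
  rewrite -exprS; apply: (@le_trans _ _ (expR 2^-1 ^+ k0.+1)).
    rewrite -expRM_natl ler_expR; have := truncnS_gt (eps / 16 * n%:R / 4).
    by rewrite -/k0; lra.
  by rewrite lerXn2r ?nnegrE ?expR_ge0// expR_half_le2.
rewrite ler_pdivrMr ?exprn_gt0//.
have -> : 2 * x ^+ v = delta / 4 * (8 * delta^-1 * x ^+ v).
  by field; rewrite gt_eqF.
rewrite ler_pM2l ?divr_gt0// -(@ler_pM2l _ 2)//.
apply: le_trans tk.
have e16 : 16 <= expR 4 :> R.
  have e2 := two_le_expR1; rewrite -[X in expR X]mulr1 expRM_natl.
  rewrite (@le_trans _ _ (2 ^+ 4))//; first by rewrite -natrX ler_nat.
  by rewrite lerXn2r ?nnegrE ?expR_ge0.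
have dE : delta^-1 <= expR ld.
  by rewrite -[leLHS]lnK ?posrE ?invr_gt0// ler_expR.
apply: (@le_trans _ _ (expR 4 * expR ld * expR (a * (2 + (12 + 7 * L) + 2 * D)))).
  rewrite mulrA mulrA ler_pM ?exprn_ge0 ?mulr_ge0 ?invr_ge0 ?(ltW delta0) ?(le_trans _ x1)//.
  by rewrite ler_pM ?invr_ge0 ?(ltW delta0)//; lra.
rewrite -!expRD ler_expR.
have aL : 2 * (a * L) <= a * D * L.
  by rewrite mulrCA mulrA ler_wpM2r ?ler_wpM2l//; lra.
have aD1 : a * D <= a * D * L by rewrite ler_peMr.
have a1 : 2 * a <= a * D by rewrite mulrC ler_wpM2l.
lra.
Qed.

(** As [eps < 1], the lower bound on [m] gives [eps * m / 16 >= 4 * (a * lg + ld)], which covers the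
    logarithm of the number of candidates, that of [delta^-1] and the constants. The successor
    counts the failure event of the reference candidate. *)
Lemma labelled_size (a ld lg eps delta : R) (n m w : nat) :
  0 < eps < 1 -> 0 < delta -> w%:R <= a -> 1 <= ld -> (0 < n)%N ->
  ln delta^-1 <= ld -> ln n%:R <= lg -> 1 <= lg ->
  64 * (a * lg + ld) / eps ^+ 2 <= m%:R ->
  ((n.+1 ^ w).+1)%:R * expR (- (eps * m%:R / 16)) <= delta / 2.
Proof.
move=> /andP[eps0 eps1] delta0 wa ld1 n0 lnd lnn lg1 Km.
have a0 : 0 <= a by rewrite (le_trans _ wa).
have alg0 : 0 <= a * lg by rewrite mulr_ge0//; lra.
have e1 := two_le_expR1.
have n1e : (n.+1)%:R <= expR (1 + lg) :> R.
  rewrite expRD (@le_trans _ _ (2 * n%:R))//.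
    rewrite -natrM ler_nat; case: n n0 {lnn} => // n _.
    by rewrite mul2n -addnn addSn ltnS leq_addl.
  by rewrite ler_pM// -[leLHS]lnK ?posrE ?ltr0n// ler_expR.
have nw : ((n.+1 ^ w)%:R <= expR (a * (1 + lg)) :> R).
  by rewrite natrX; apply: powX_le_expR; rewrite ?ler1n.
have em : 4 * (a * lg + ld) <= eps * m%:R / 16.
  have : eps ^+ 2 * m%:R <= eps * m%:R.
    by rewrite ler_wpM2r// expr2 ler_piMl// ltW.
  have : 64 * (a * lg + ld) <= eps ^+ 2 * m%:R.
    by move: Km; rewrite ler_pdivrMr ?exprn_gt0// [m%:R * _]mulrC.
  by lra.
rewrite expRN ler_pdivrMr ?expR_gt0//.
have dE : delta^-1 <= expR ld.
  by rewrite -[leLHS]lnK ?posrE ?invr_gt0// ler_expR.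
have one : 1 <= expR (a * (1 + lg)).
  by rewrite -[leLHS]expR0 ler_expR mulr_ge0//; lra.
apply: (@le_trans _ _ (2 * expR (a * (1 + lg)))).
  by rewrite -natr1; lra.
have -> : 2 * expR (a * (1 + lg)) =
    delta / 2 * (2 * 2 * (delta^-1 * expR (a * (1 + lg)))).
  by field; rewrite gt_eqF.
rewrite ler_pM2l ?divr_gt0//.
apply: (@le_trans _ _ (expR 1 * expR 1 * (expR ld * expR (a * (1 + lg))))).
  by rewrite !ler_pM ?mulr_ge0 ?invr_ge0 ?(ltW delta0) ?expR_ge0.
rewrite -!expRD ler_expR.
have : a <= a * lg by rewrite ler_peMr.
lra.
Qed.

(** With [g = 1 + gamma^-1] the base is [1 + g * d <= 2 * g * d]; the factor 2 costs at most 1 in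
    the exponent, which the doubling absorbs because both values of [log1] are at least 1. *)
Lemma cover_multiplicity (d : nat) (gamma : R) : (0 < d)%N -> 0 < gamma ->
  (1 + (1 + gamma) * d%:R / gamma) ^+ d <=
  expR (2 * (d%:R * (log1 (1 + gamma^-1) + log1 d%:R))).
Proof.
move=> d0 g0; set g := 1 + gamma^-1.
have g1 : 1 <= g by rewrite lerDl invr_ge0 ltW.
have d1 : 1 <= d%:R :> R by rewrite ler1n.
have -> : (1 + gamma) * d%:R / gamma = g * d%:R.
  by rewrite /g; field; rewrite gt_eqF.
rewrite mulrCA expRM_natl lerXn2r ?nnegrE ?expR_ge0//.
  by rewrite addr_ge0// mulr_ge0//; lra.
have le_exp_log1 t : 0 < t -> t <= expR (log1 t).
  by move=> t0; rewrite -[leLHS]lnK ?posrE// ler_expR ln_le_log1.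
apply: (@le_trans _ _ (2 * (g * d%:R))).
  by have : 1 * 1 <= g * d%:R; [rewrite ler_pM|lra].
apply: (@le_trans _ _ (expR 1 * (expR (log1 g) * expR (log1 d%:R)))).
  by rewrite !ler_pM ?mulr_ge0 ?two_le_expR1 ?le_exp_log1//; lra.
rewrite -!expRD ler_expR.
have := log1_ge1 g; have := log1_ge1 d%:R; lra.
Qed.

(** This breaks the circularity between [n] and the [ln n] coming from the growth function: [n] is
    at most a polynomial in [Q] times [log1 Q], so [ln n] is of the order of [log1 Q]. *)
Lemma unlabelled_size_log (a gamma eps delta Q : R) (d n : nat) :
  (0 < d)%N -> 0 < gamma -> 0 < eps < 1 -> 0 < delta < 1 -> 0 <= a ->
  a <= Q -> d%:R <= Q -> gamma^-1 <= Q -> delta^-1 <= Q -> eps^-1 <= Q ->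
  n%:R <= 64 * 64 * ((a * (d%:R * (log1 (1 + gamma^-1) + log1 d%:R)) +
    log1 delta^-1) / eps) * log1 Q ->
  n%:R <= expR (12 + 7 * log1 Q).
Proof.
move=> d0 g0 /andP[eps0 eps1] /andP[del0 del1] a0 aQ dQ gQ delQ epsQ.
move=> /le_trans; apply.
have d1 : 1 <= d%:R :> R by rewrite ler1n.
have Q1 : 1 <= Q by lra.
have Q0 : 0 <= Q by lra.
have gi0 : 0 < gamma^-1 by rewrite invr_gt0.
have del1' : 1 <= delta^-1 by rewrite invf_ge1// ltW.
have lg : log1 (1 + gamma^-1) <= 2 * Q.
  by rewrite (le_trans (log1_le_self _))//; lra.
have ldd : log1 d%:R <= Q by rewrite (le_trans (log1_le_self _)).
have ldel : log1 delta^-1 <= Q by rewrite (le_trans (log1_le_self _)).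
have lg0 := log1_ge1 (1 + gamma^-1); have ld0 := log1_ge1 d%:R.
have ldel0 := log1_ge1 delta^-1; have L1 := log1_ge1 Q.
set D := d%:R * _; have D0 : 0 <= D by rewrite mulr_ge0//; lra.
have DQ : D <= Q * (3 * Q) by rewrite ler_pM//; lra.
have aD : a * D <= Q * (Q * (3 * Q)) by rewrite ler_pM.
have QQ : 1 * Q <= Q * Q by rewrite ler_pM.
have QQQ : Q * Q <= Q * (Q * Q) by rewrite ler_wpM2l// -[leLHS]mul1r.
have num : a * D + log1 delta^-1 <= 4 * (Q * (Q * Q)).
  have E3 : Q * (Q * (3 * Q)) = 3 * (Q * (Q * Q)) by ring.
  have : Q <= Q * (Q * Q) by rewrite (le_trans _ QQQ)// -[leLHS]mul1r.
  by rewrite E3 in aD; lra.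
have num0 : 0 <= a * D + log1 delta^-1 by rewrite addr_ge0 ?mulr_ge0//; lra.
have M4 : (a * D + log1 delta^-1) / eps <= 4 * (Q * (Q * Q)) * Q.
  by rewrite ler_pM// invr_ge0 ltW.
have QL : Q <= expR (log1 Q).
  by rewrite -{1}[Q]lnK ?posrE ?ler_expR ?ln_le_log1//; lra.
have LE : log1 Q <= expR (log1 Q) by rewrite (le_trans _ (expR_ge1Dx _))// lerDr.
have Q4 : 4 * (Q * (Q * Q)) * Q <= 4 * expR (4 * log1 Q).
  rewrite -mulrA ler_pM2l//.
  rewrite (_ : Q * (Q * Q) * Q = Q ^+ 4); last by ring.
  by rewrite expRM_natl lerXn2r ?nnegrE ?expR_ge0.
have e2 := two_le_expR1.
have e6 : 64 <= expR 6 :> R.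
  rewrite -[X in expR X]mulr1 expRM_natl (@le_trans _ _ (2 ^+ 6))//.
    by rewrite -natrX ler_nat.
  by rewrite lerXn2r ?nnegrE ?expR_ge0.
have e12 : 64 * 64 <= expR 12 :> R.
  have -> : 12 = 6 + 6 :> R by ring.
  by rewrite expRD ler_pM.
have e4 : 4 <= expR (2 * log1 Q).
  rewrite expRM_natl (@le_trans _ _ (2 ^+ 2))//.
    by rewrite -natrX ler_nat.
  rewrite lerXn2r ?nnegrE ?expR_ge0// (le_trans e2)// ler_expR//.
rewrite (_ : 12 + 7 * log1 Q = 12 + (2 * log1 Q + 4 * log1 Q) + log1 Q); last by ring.
rewrite 2!expRD.
have L0 : 0 <= log1 Q by lra.
have M0 : 0 <= (a * D + log1 delta^-1) / eps by rewrite divr_ge0// ltW.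
apply: ler_pM L0 _ LE; first by rewrite mulr_ge0// mulr_ge0.
apply: ler_pM M0 e12 _; first by rewrite mulr_ge0.
rewrite (le_trans M4)// (le_trans Q4)// expRD ler_wpM2r// expR_ge0.
Qed.

Lemma soft_bigO_log1 (c g : R) (qs : seq R) (m : nat) : 1 <= c -> 0 <= g ->
  m%:R <= c * g * log1 (\big[Num.max/0]_(q <- qs) q) -> soft_bigO c g qs m.
Proof.
move=> c1 g0 /le_trans; apply; set L := log1 _.
have L1 : 1 <= L by exact: log1_ge1.
apply: ler_wpM2l; first by rewrite mulr_ge0//; lra.
by rewrite -[leLHS]powRr1 ?ler_powR//; lra.
Qed.

End numerics.

(** * Independent draws and Chernoff bounds *)

Lemma measurable_map_tuple d d' (T : measurableType d) (T' : measurableType d')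
    (f : T -> T') n : measurable_fun [set: T] f ->
  measurable_fun [set: n.-tuple T] (@map_tuple n T T' f).
Proof.
move=> mf; apply/measurable_fun_tnthP => i.
rewrite (_ : _ \o _ = f \o (fun t => tnth t i)).
  by apply: measurableT_comp => //; exact: measurable_tnth.
by apply/funext => t /=; rewrite tnth_map.
Qed.

Lemma measurable_forall_tnth d (T : measurableType d) n (A : 'I_n -> set T) :
  (forall i, measurable (A i)) ->
  measurable [set t : n.-tuple T | forall i, A i (tnth t i)].
Proof.
move=> mA; rewrite (_ : [set t | _] =
    \bigcap_(i in setT) ((fun t => tnth t i) @^-1` A i)).
  apply: fin_bigcap_measurable => // i _.
  by rewrite -[X in measurable X]setTI; exact: measurable_tnth.
by apply/seteqP; split => t /= h i; [move=> _; exact: h | exact: (h i I)].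
Qed.

Section iid.
Context {R : realType} {d : measure_display} {T : measurableType d}.
Variable P : probability T R.

Lemma iidS n (B : set (n.+1.-tuple T)) :
  iid P n.+1 B = (\int[P]_x iid P n [set t | B (cons_pair (x, t))])%E.
Proof.
rewrite /= /distribution /pushforward /= /product_measure1.
apply: eq_integral => x _ /=; congr (iid P n _).
by apply/seteqP; split => t; rewrite /= xsectionE.
Qed.

(** Tonelli peels off one draw at a time. For [g] equal to [b] on an event and 1 off it, this is the
    generating function of the number of hits. *)
Lemma iid_integral_prod n (g : T -> R) (a : R) :
  measurable_fun [set: T] g -> (forall x, 0 <= g x) ->
  (\int[P]_x (g x)%:E = a%:E)%E ->
  (\int[iid P n]_s (\prod_(i < n) g (tnth s i))%:E = (a ^+ n)%:E)%E.
Proof.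
move=> mg g0 ga.
have mprod m : measurable_fun [set: m.-tuple T]
    (fun s => \prod_(i < m) g (tnth s i)).
  apply: measurable_prod => i _; apply: measurableT_comp => //.
  exact: measurable_tnth.
have prod_ge0 m (s : m.-tuple T) : 0 <= \prod_(i < m) g (tnth s i).
  by apply: prodr_ge0.
elim: n => [|n IH].
  under eq_integral do rewrite big_ord0.
  by rewrite integral_cst//= probability_setT mule1.
rewrite ge0_integral_distribution//; last 2 first.
- by apply/measurable_EFinP; exact (mprod _).
- by move=> s; rewrite lee_fin.
rewrite fubini_tonelli1//=; last 2 first.
- apply/measurable_EFinP; exact (measurableT_comp (mprod n.+1) (@measurable_cons_pair _ T n)).
- by move=> z; rewrite lee_fin; exact: (prod_ge0 n.+1).
under eq_integral => x _.
  rewrite /fubini_F /=.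
  under eq_integral => t _.
    rewrite big_ord_recl (tnth_nth x)/= EFinM.
    under eq_bigr do rewrite tnthS.
    over.
  rewrite ge0_integralZl_EFin//; last 2 first.
  - by move=> s _; rewrite lee_fin; exact: prod_ge0.
  - by apply/measurable_EFinP; exact (mprod _).
  rewrite IH.
  over.
rewrite ge0_integralZr//.
- by rewrite ga -EFinM exprS.
- exact/measurable_EFinP.
- by move=> x _; rewrite lee_fin.
- by rewrite lee_fin exprn_ge0// -lee_fin -ga integral_ge0// => x _; rewrite lee_fin.
Qed.

Definition hits (E : set T) n (s : n.-tuple T) : nat :=
  #|[pred i | `[< E (tnth s i) >]]|.

Lemma prod_hits (E : set T) n (s : n.-tuple T) (b : R) :
  \prod_(i < n) (if `[< E (tnth s i) >] then b else 1) = b ^+ hits E s.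
Proof. by rewrite -big_mkcond/= prodr_const. Qed.

(** Markov's inequality for [b ^+ hits E s], whose mean is [(1 - p + p * b) ^+ n]. Lower tails use
    [b < 1], upper tails [b > 1]. *)
Lemma chernoff n (E : set T) (p b c : R) (B : set (n.-tuple T)) :
  measurable E -> P E = p%:E -> 0 <= b -> 0 < c -> measurable B ->
  (forall s, B s -> c <= b ^+ hits E s) ->
  (iid P n B <= ((1 - p + p * b) ^+ n / c)%:E)%E.
Proof.
move=> mE PE b0 c0 mB Bc.
pose g x := if `[< E x >] then b else 1.
have gE x : g x = \1_(~` E) x + b * \1_E x.
  rewrite /g !indicE in_setC; case: asboolP => Ex.
    by rewrite mem_set//= add0r mulr1.
  by rewrite memNset//= mulr0 addr0.
have mg : measurable_fun [set: T] g.
  rewrite (funext gE).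
  apply: measurable_funD; first exact/measurable_indic/measurableC.
  by apply: measurable_funM => //; exact/measurable_indic.
have g0 x : 0 <= g x by rewrite /g; case: ifP.
have ga : (\int[P]_x (g x)%:E = (1 - p + p * b)%:E)%E.
  under eq_integral do rewrite gE EFinD EFinM.
  rewrite ge0_integralD//; last 3 first.
  - exact/measurable_EFinP/measurable_indic/measurableC.
  - by move=> x _; rewrite -EFinM lee_fin mulr_ge0.
  - by apply: measurable_funeM; exact/measurable_EFinP/measurable_indic.
  rewrite ge0_integralZl_EFin//; last exact/measurable_EFinP/measurable_indic.
  rewrite !integral_indic//; last exact: measurableC.
  rewrite !setIT; transitivity ((1 - P E) + b%:E * P E)%E.
    by congr (_ + _)%E; exact: probability_setC.
  by rewrite PE -EFinM -EFinD [b * p]mulrC.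
have mG : measurable_fun [set: n.-tuple T] (fun s => \prod_(i < n) g (tnth s i)).
  apply: measurable_prod => i _.
  by apply: measurableT_comp => //; exact: measurable_tnth.
rewrite EFinM muleC -lee_pdivrMl ?invr_gt0// invrK muleC.
rewrite -(iid_integral_prod n mg g0 ga).
have -> : (iid P n B * c%:E = \int[iid P n]_s (c * \1_B s)%:E)%E.
  under eq_integral do rewrite EFinM.
  rewrite ge0_integralZl_EFin ?ltW//; last first.
    exact/measurable_EFinP/measurable_indic.
  by rewrite integral_indic// setIT muleC.
apply: ge0_le_integral => //.
- by move=> s _; rewrite lee_fin mulr_ge0// ltW.
- exact/measurable_EFinP/measurable_funM.
- by apply/measurable_EFinP; exact mG.
- move=> s _; rewrite lee_fin /g prod_hits indicE.
  case: (boolP (s \in B)) => [/set_mem/Bc|_]; first by rewrite mulr1.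
  by rewrite mulr0 exprn_ge0.
Qed.

(** Take [b = 1/2]: [1 - p / 2 <= expR (- (p / 2))] and [expR (-1) <= 1/2] leave the exponent
    [- p * n / 2 + e * n / 4]. *)
Lemma few_hits_tail n (E : set T) (p e : R) (B : set (n.-tuple T)) :
  measurable E -> P E = p%:E -> e <= p -> measurable B ->
  (forall s, B s -> (hits E s)%:R <= e * n%:R / 4) ->
  (iid P n B <= (expR (- (e * n%:R / 4)))%:E)%E.
Proof.
move=> mE PE ep mB Bhits.
have p01 : 0 <= p <= 1.
  by rewrite -!lee_fin -PE measure_ge0 probability_le1.
set x := e * n%:R / 4 in Bhits *.
have ie : expR (-1) <= 2^-1 :> R.
  by rewrite expRN lef_pV2 ?posrE ?expR_gt0// two_le_expR1.
apply: (le_trans (chernoff (b := 2^-1) (c := expR (- x)) mE PE _ _ mB _)).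
- lra.
- exact: expR_gt0.
- move=> s /Bhits hx; rewrite (@le_trans _ _ (expR (-1) ^+ hits E s))//.
    by rewrite -expRM_natl ler_expR mulrN1 lerN2.
  by rewrite lerXn2r ?nnegrE ?expR_ge0//; lra.
rewrite lee_fin ler_pdivrMr ?expR_gt0// -expRD.
rewrite (@le_trans _ _ (expR (- (p / 2)) ^+ n))//.
  rewrite lerXn2r ?nnegrE ?expR_ge0//; first lra.
  by rewrite (le_trans _ (expR_ge1Dx _))//; lra.
rewrite -expRM_natl ler_expR /x.
have : e * n%:R <= p * n%:R by rewrite ler_wpM2r.
by move=> {PE}; lra.
Qed.

(** Take [b = 2]: [1 + p <= expR p] and [expR 2^-1 <= 2] leave the exponent [p * n - e * n / 8]. *)
Lemma many_hits_tail n (E : set T) (p e : R) (B : set (n.-tuple T)) :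
  measurable E -> P E = p%:E -> p <= e / 16 -> measurable B ->
  (forall s, B s -> e * n%:R / 4 <= (hits E s)%:R) ->
  (iid P n B <= (expR (- (e * n%:R / 16)))%:E)%E.
Proof.
move=> mE PE ep mB Bhits.
have p01 : 0 <= p <= 1.
  by rewrite -!lee_fin -PE measure_ge0 probability_le1.
apply: (le_trans (chernoff (b := 2) (c := expR (e * n%:R / 8)) mE PE _ _ mB _)).
- lra.
- exact: expR_gt0.
- move=> s /Bhits hx; rewrite (@le_trans _ _ (expR (2^-1) ^+ hits E s))//.
    by rewrite -expRM_natl ler_expR; lra.
  by rewrite lerXn2r ?nnegrE ?expR_ge0// expR_half_le2.
rewrite lee_fin ler_pdivrMr ?expR_gt0// -expRD.
rewrite (@le_trans _ _ (expR p ^+ n))//.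
  rewrite lerXn2r ?nnegrE ?expR_ge0//; first lra.
  by rewrite (le_trans _ (expR_ge1Dx _))//; lra.
rewrite -expRM_natl ler_expR.
have : p * n%:R <= e / 16 * n%:R by rewrite ler_wpM2r.
by move=> {PE}; lra.
Qed.

End iid.

(** This carries events on coded samples back to the original samples, and events on inputs back to
    labelled samples. *)
Lemma iid_distribution {R : realType} {d d' : measure_display}
    {T : measurableType d} {T' : measurableType d'} (P : probability T R)
    (f : {mfun T >-> T'}) n (A : set (n.-tuple T')) : measurable A ->
  iid (distribution P f) n A = iid P n [set t | A (map_tuple f t)].
Proof.
elim: n A => [|n IH] A mA.
  have e : map_tuple f [tuple] = [tuple] by exact: tuple0.
  rewrite /= !diracE; have [A0|A0] := pselect (A [tuple]).
    by rewrite !mem_set//= e.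
  by rewrite !memNset//= e.
rewrite !iidS ge0_integral_distribution//; last first.
  rewrite (_ : (fun _ => _) =
    iid (distribution P f) n \o xsection (@cons_pair T' n @^-1` A)).
    apply: measurable_fun_xsection.
    by rewrite -[X in measurable X]setTI; exact: measurable_cons_pair.
  by apply/funext => x /=; rewrite xsectionE.
apply: eq_integral => x _ /=; rewrite IH; last first.
  rewrite -[X in measurable X]setTI.
  by apply: (measurable_cons (f := cst (f x)) (g := id)).
congr (iid P n _); apply/seteqP; split => t /=;
  by congr A; apply: val_inj.
Qed.

(** * Uniform convergence by double sampling *)

Lemma measurable_nat_tuple n (A : set (n.-tuple nat)) : measurable A.
Proof.
apply: countable_measurable => [t|]; last exact: countableP.
rewrite (_ : [set t] = [set s | forall i, [set tnth t i] (tnth s i)]).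
  exact: (measurable_forall_tnth (A := fun i => [set tnth t i])).
apply/seteqP; split => [_ -> //|s /= st].
by apply: eq_from_tnth => i; exact: st.
Qed.

Lemma measurable_nat_fun {R : realType} n (f : n.-tuple nat -> \bar R) :
  measurable_fun [set: n.-tuple nat] f.
Proof. by rewrite /measurable_fun => *; exact: measurable_nat_tuple. Qed.

Lemma measurable_nat_tuple2 n (A : set (n.-tuple nat * n.-tuple nat)) :
  measurable A.
Proof.
apply: countable_measurable => [[a b]|]; last exact: countableP.
rewrite (_ : [set (a, b)] = [set a] `*` [set b]).
  by apply: measurableX; exact: measurable_nat_tuple.
by apply/seteqP; split => [_ -> //|[x y] /= [-> ->]].
Qed.

(** On a countable space with measurable singletons a measure is determined by its point masses. The
    unions are indexed by codes, so that countable additivity over [nat] applies. *)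
Lemma measure_involution {R : realType} d (T : measurableType d)
    (m : {measure set T -> \bar R}) (code : T -> nat) (f : T -> T) (A : set T) :
  injective code -> (forall x : T, measurable [set x]) -> involutive f ->
  (forall x, m [set f x] = m [set x]) -> m (f @^-1` A) = m A.
Proof.
move=> ic m1 fK fm.
have e1 x : [set y | code y = code x] = [set x].
  by apply/seteqP; split => y /= => [/ic ->|->].
have e2 x : [set y | code (f y) = code x] = [set f x].
  by apply/seteqP; split => y /= => [/ic <-|->]; rewrite fK.
have U (g : T -> T) : g @^-1` A =
    \bigcup_(k in code @` A) [set y | code (g y) = k].
  apply/seteqP; split => [y Ay|y [_ [x Ax <-]] /= /ic -> //].
  by exists (code (g y)) => //; exists (g y).
have tr (g : T -> T) : trivIset (code @` A) (fun k => [set y | code (g y) = k]).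
  by move=> i j _ _ [y [/= <- <-]].
rewrite [A in RHS](U id) (U f) !measure_bigcup//.
- apply: eq_eseriesr => k /set_mem[x Ax <-].
  by rewrite e2 fm; congr (m _); rewrite -[LHS]e1.
- by move=> _ [x Ax <-]; rewrite /= e1.
- by move=> _ [x Ax <-]; rewrite e2.
Qed.

Section double_sample.
Context {R : realType}.
Variables (Q : probability nat R) (cls : set (set nat)) (n : nat).

Local Notation mu := (iid Q n).
Local Notation m := (iid Q n \x iid Q n)%E.

(** The Vapnik-Chervonenkis symmetrisation: [sg] marks the positions at which the sample and the
    ghost sample exchange their points. *)
Definition mix (sg : {ffun 'I_n -> bool}) (s s' : n.-tuple nat) : n.-tuple nat :=
  [tuple if sg i then tnth s' i else tnth s i | i < n].

Definition swap (sg : {ffun 'I_n -> bool}) (w : n.-tuple nat * n.-tuple nat) :=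
  (mix sg w.1 w.2, mix sg w.2 w.1).

Lemma swapK sg : involutive (swap sg).
Proof.
move=> [s s']; rewrite /swap /=; congr pair;
  by apply: eq_from_tnth => i; rewrite !tnth_mktuple; case: (sg i).
Qed.

Lemma iid_set1 (s : n.-tuple nat) :
  mu [set s] = (\prod_(i < n) Q [set tnth s i])%E.
Proof.
rewrite -iid_rect//; congr (mu _); apply/seteqP; split => [_ -> //|t /= h].
by apply: eq_from_tnth => i; exact: h.
Qed.

(** The mass of a single pair is a product over positions of factors symmetric in the two
    samples. *)
Lemma swap_preserving sg (B : set (n.-tuple nat * n.-tuple nat)) :
  m (swap sg @^-1` B) = m B.
Proof.
have m1 (w : n.-tuple nat * n.-tuple nat) :
    m [set w] = (\prod_(i < n) (Q [set tnth w.1 i] * Q [set tnth w.2 i]))%E.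
  case: w => s s'; rewrite big_split/= -!iid_set1.
  rewrite -product_measure1E//; last 2 first.
  - exact: measurable_nat_tuple.
  - exact: measurable_nat_tuple.
  by congr (m _); apply/seteqP; split => [_ -> //|[x y] /= [-> ->]].
apply: (@measure_involution _ _ _ m (@choice.pickle _)).
- exact: (pcan_inj choice.pickleK).
- by move=> x; exact: measurable_nat_tuple2.
- exact: swapK.
- move=> w; suff : m [set swap sg w] = m [set w] by [].
  rewrite !m1; apply: eq_bigr => i _; rewrite !tnth_mktuple.
  by case: (sg i) => //; rewrite muleC.
Qed.

Definition missed_heavy (e : R) : set (n.-tuple nat) :=
  [set s | exists2 E, cls E /\ (e%:E < Q E)%E & forall i, ~ E (tnth s i)].

(** Here [w.1] is the sample and [w.2] the ghost sample. *)
Definition missed_then_hit (k : nat) : set (n.-tuple nat * n.-tuple nat) :=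
  [set w | exists2 E, cls E &
     (forall i, ~ E (tnth w.1 i)) /\ (k <= hits E w.2)%N].

Definition trace l (s : l.-tuple nat) : pred (l.-tuple bool) :=
  [pred y | `[< exists2 E, cls E &
     forall i, tnth y i = `[< E (tnth s i) >] >]].

Lemma card_ffun_prescribed (J p : pred 'I_n) :
  (#|[pred sg : {ffun 'I_n -> bool} | [forall i, J i ==> (sg i == p i)]]|
   = 2 ^ (n - #|J|))%N.
Proof.
pose F i : pred bool := fun b => J i ==> (b == p i).
rewrite (@eq_card _ _ (family F)); last first.
  by move=> sg; rewrite [LHS]inE; apply/forallP/familyP.
rewrite card_family foldrE big_map big_enum/=.
rewrite (eq_bigr (fun i => if ~~ J i then 2 else 1)%N); last first.
  move=> i _; rewrite /F; case: (J i) => /=; last by rewrite -card_bool.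
  by rewrite -(card1 (p i)).
rewrite -big_mkcond/= prod_nat_const; congr (_ ^ _)%N.
have cJ : (#|J| + #|[predC J]| = n)%N by rewrite cardC card_ord.
have -> : (n - #|J| = #|[predC J]|)%N by rewrite -[X in (X - _)%N]cJ addKn.
by apply: eq_card.
Qed.

(** Fix the trace [y] of [E] on the double sample, and let [J y] be the positions where at least one
    of the two points lies in [E]. For the swapped first sample to miss [E], the swap is forced on
    [J y]: exchange exactly when the first point lies in [E]. All hits of the second sample occur on
    [J y], so at least [k] positions are forced and at most [2 ^ (n - k)] swaps remain per trace. *)
Lemma card_swaps_missed_then_hit (N k : nat) (w : n.-tuple nat * n.-tuple nat) :
  (#|trace (cat_tuple w.1 w.2)| <= N)%N ->
  (#|[pred sg | `[< missed_then_hit k (swap sg w) >]]| <= N * 2 ^ (n - k))%N.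
Proof.
move=> trN; set s := cat_tuple _ _ in trN.
pose p (y : (n + n).-tuple bool) := [pred i | tnth y (lshift n i)].
pose q (y : (n + n).-tuple bool) := [pred i | tnth y (rshift n i)].
pose J y := [pred i | p y i || q y i].
pose F y := [pred sg : {ffun 'I_n -> bool} |
  [forall i, J y i ==> (sg i == p y i)]].
pose Pk y := (y \in trace s) && (k <= #|J y|)%N.
have cover sg : missed_then_hit k (swap sg w) -> exists2 y, Pk y & sg \in F y.
  move=> [E clsE [miss hit]].
  pose y := [tuple `[< E (tnth s i) >] | i < n + n].
  have py i : p y i = `[< E (tnth w.1 i) >].
    by rewrite /= tnth_mktuple tnth_lshift.
  have qy i : q y i = `[< E (tnth w.2 i) >].
    by rewrite /= tnth_mktuple tnth_rshift.
  exists y.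
    rewrite /Pk; apply/andP; split.
      by apply/asboolP; exists E => // i; rewrite tnth_mktuple.
    rewrite (leq_trans hit)//; apply/subset_leq_card/fintype.subsetP => i.
    rewrite !inE -[tnth y (lshift _ _)]/(p y i) -[tnth y (rshift _ _)]/(q y i).
    rewrite py qy /= tnth_mktuple.
    by case: (sg i) => /asboolT ->; rewrite ?orbT.
  rewrite inE; apply/forallP => i; apply/implyP.
  rewrite /J /= -[tnth y (lshift _ _)]/(p y i) -[tnth y (rshift _ _)]/(q y i).
  rewrite py qy; have := miss i; rewrite /= tnth_mktuple.
  by case: (sg i) => /asboolPn/negbTE ->; rewrite ?orbF//= => ->.
rewrite -sum1_card.
(* Double counting of the pairs of a swap and a trace compatible with it. *)
apply: (@leq_trans (\sum_(sg : {ffun 'I_n -> bool}) \sum_(y | Pk y) (sg \in F y))).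
  rewrite big_mkcond leq_sum// => sg _; case: ifP => // Bsg.
  have [y Pky Fy] : exists2 y, Pk y & sg \in F y.
    by apply: cover; move: Bsg; rewrite !inE.
  by rewrite (bigD1 y)//= Fy.
rewrite exchange_big/=.
apply: (@leq_trans (\sum_(y | Pk y) 2 ^ (n - k))).
  apply: leq_sum => y /andP[_ kJ].
  rewrite -big_mkcond/= sum1_card.
  rewrite (leq_trans _ (_ : 2 ^ (n - #|J y|) <= _)%N) ?leq_exp2l ?leq_sub2l//.
  by rewrite -(card_ffun_prescribed (J y) (p y)); apply/eq_leq/eq_card.
rewrite sum_nat_const leq_mul2r; apply/orP; right.
rewrite (leq_trans _ trN)//; apply/subset_leq_card/fintype.subsetP => y.
by move=> /andP[].
Qed.

(** Average over all [2 ^ n] swaps: each preserves the measure, and for every fixed pair at most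
    [N * 2 ^ (n - k)] of them land in the event. *)
Lemma double_sample_bound (N k : nat) : (k <= n)%N ->
  (forall s : (n + n).-tuple nat, #|trace s| <= N)%N ->
  (m (missed_then_hit k) <= (N%:R / 2 ^+ k)%:E)%E.
Proof.
move=> kn trN; set B := missed_then_hit k.
have mB sg : measurable (swap sg @^-1` B) by exact: measurable_nat_tuple2.
have : ((2 ^+ n)%:E * m B <= (N%:R * 2 ^+ (n - k))%:E)%E.
  have -> : ((2 ^+ n)%:E * m B =
      \sum_(sg : {ffun 'I_n -> bool}) m (swap sg @^-1` B))%E.
    under eq_bigr do rewrite swap_preserving.
    have mfin : m B \is a fin_num.
      have Ble1 : (m B <= 1)%E.
        by apply: probability_le1; exact: measurable_nat_tuple2.
      by rewrite ge0_fin_numE ?(le_lt_trans Ble1) ?ltry// measure_ge0.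
    rewrite -(fineK mfin).
    by rewrite sumEFin sumr_const card_ffun card_bool card_ord -EFinM -natrX mulr_natl.
  have -> : (\sum_(sg : {ffun 'I_n -> bool}) m (swap sg @^-1` B) =
      \int[m]_w \sum_(sg : {ffun 'I_n -> bool}) (\1_(swap sg @^-1` B) w)%:E)%E.
    rewrite ge0_integral_sum//; last first.
      by move=> sg; exact/measurable_EFinP/measurable_indic.
    by apply: eq_bigr => sg _; rewrite integral_indic// setIT.
  have <- : (\int[m]_w (cst (N%:R * 2 ^+ (n - k))%:E) w =
      (N%:R * 2 ^+ (n - k))%:E)%E.
    by rewrite integral_cst//= -[X in (_ * X)%E]/(m setT) probability_setT mule1.
  apply: ge0_le_integral => //.
  - by move=> w _; apply: sume_ge0.
  - apply: emeasurable_sum => sg.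
    exact/measurable_EFinP/measurable_indic.
  - move=> w _; rewrite sumEFin lee_fin /=.
    under eq_bigr do rewrite indicE.
    rewrite -natr_sum -natrX -natrM ler_nat.
    rewrite (leq_trans _ (card_swaps_missed_then_hit k (w := w) (trN _)))//.
    rewrite -sum1_card [leqRHS]big_mkcond; apply: leq_sum => sg _.
    by rewrite inE; case: ifP => [/asboolP h|/asboolP h];
      [rewrite mem_set|rewrite memNset].
rewrite -lee_pdivlMl ?exprn_gt0// -EFinM => h; rewrite (le_trans h)// lee_fin.
rewrite -{1}(subnKC kn) exprD.
have := @expf_neq0 R 2 k; have := @expf_neq0 R 2 (n - k).
rewrite pnatr_eq0 => /(_ isT) y0 /(_ isT) x0.
by rewrite le_eqVlt; apply/orP; left; apply/eqP; field; rewrite x0 y0.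
Qed.

(** If a sample misses a heavy set, an independent ghost sample hits this set at least [k] times
    with probability at least 1/2; hence the event costs at most twice [missed_then_hit]. *)
Lemma missed_heavy_bound (e : R) (N k : nat) :
  k%:R <= e * n%:R / 4 -> 4 <= e * n%:R -> (k <= n)%N ->
  (forall s : (n + n).-tuple nat, #|trace s| <= N)%N ->
  (mu (missed_heavy e) <= (2 * N%:R / 2 ^+ k)%:E)%E.
Proof.
move=> ke en kn trN.
have half s : missed_heavy e s ->
    (2^-1%:E <= mu (xsection (missed_then_hit k) s))%E.
  move=> [E [clsE eE] miss].
  pose B := [set s' : n.-tuple nat | (hits E s' < k)%N].
  have QE : Q E = (fine (Q E))%:E by rewrite fineK// fin_num_measure.
  have tail : (mu B <= (expR (- (e * n%:R / 4)))%:E)%E.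
    apply: (few_hits_tail _ QE) => //.
    - by rewrite -lee_fin -QE ltW.
    - exact: measurable_nat_tuple.
    - by move=> s' /ltnW hk; rewrite (le_trans _ ke)// ler_nat.
  (* As [4 <= e * n], the exponent is at least 1 in absolute value. *)
  have B2 : (mu B <= 2^-1%:E)%E.
    rewrite (le_trans tail)// lee_fin expRN lef_pV2 ?posrE ?expR_gt0//.
    rewrite (le_trans _ (expR_ge1Dx _))//; lra.
  apply: (@le_trans _ _ (mu (~` B))).
    have mfin : mu B \is a fin_num.
      by apply: fin_num_measure; exact: measurable_nat_tuple.
    have -> : mu (~` B) = (1 - fine (mu B))%:E.
      by rewrite EFinB fineK//; apply: probability_setC; exact: measurable_nat_tuple.
    rewrite -(fineK mfin) lee_fin in B2.
    rewrite lee_fin; clear -B2; lra.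
  apply: le_measure; rewrite ?inE; try exact: measurable_nat_tuple.
  move=> s' /= /negP; rewrite -leqNgt => hk.
  by apply/xsectionP; exists E.
have := double_sample_bound kn trN.
have : (2^-1%:E * mu (missed_heavy e) <= m (missed_then_hit k))%E.
  have -> : (2^-1%:E * mu (missed_heavy e) =
      \int[mu]_s (2^-1 * \1_(missed_heavy e) s)%:E)%E.
    under eq_integral do rewrite EFinM.
    rewrite ge0_integralZl_EFin//; last first.
      apply/measurable_EFinP/measurable_indic; exact: measurable_nat_tuple.
    by rewrite integral_indic ?setIT//; exact: measurable_nat_tuple.
  apply: ge0_le_integral => //.
  - by apply: measurable_nat_fun.
  - by apply: measurable_nat_fun.
  - move=> s _; rewrite indicE.
    have [/set_mem/half|_] := boolP (s \in _); first by rewrite mulr1.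
    by rewrite mulr0 measure_ge0.
move=> h1 /(le_trans h1); rewrite -lee_pdivlMl ?invr_gt0// invrK -EFinM.
by rewrite mulrA.
Qed.

End double_sample.

(** * The metric and the losses *)

Lemma powR_convex {R : realType} (q t x y : R) : 1 <= q -> 0 <= t <= 1 ->
  0 <= x -> 0 <= y ->
  (t * x + (1 - t) * y) `^ q <= t * x `^ q + (1 - t) * y `^ q.
Proof.
move=> q1 /andP[t0 t1] x0 y0.
have := convex_powR q1 (Itv01 t0 t1); move=> /(_ x y) /=.
rewrite !inE/= !in_itv/= !andbT => /(_ x0 y0).
exact.
Qed.

(** With [t = a / (a + b)], the quotient [(|u i| + |v i|) / (a + b)] is the convex combination of
    [|u i| / a] and [|v i| / b]; convexity of the [q]-th power is then summed. Positive bounds [a]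
    and [b] replace the norms, which may vanish. *)
Lemma minkowski_sum {R : realType} d (q a b : R) (u v : 'I_d -> R) :
  1 <= q -> 0 < a -> 0 < b ->
  \sum_i `|u i| `^ q <= a `^ q -> \sum_i `|v i| `^ q <= b `^ q ->
  \sum_i `|u i + v i| `^ q <= (a + b) `^ q.
Proof.
move=> q1 a0 b0 Sa Sb.
have q0 : 0 < q by rewrite (lt_le_trans ltr01).
have ab0 : 0 < a + b by rewrite addr_gt0.
pose t := a / (a + b).
have t01 : 0 <= t <= 1.
  by rewrite /t divr_ge0 ?(ltW a0, ltW ab0)//= ler_pdivrMr// mul1r lerDl ltW.
have tE : 1 - t = b / (a + b) by rewrite /t; field; rewrite gt_eqF.
have step i : `|u i + v i| `^ q <=
    (a + b) `^ q * (t * (`|u i| `^ q / a `^ q) + (1 - t) * (`|v i| `^ q / b `^ q)).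
  have div_pow x c : 0 < c -> `|x| `^ q / c `^ q = (`|x| / c) `^ q :> R.
    move=> c0; rewrite powRM ?invr_ge0 ?(ltW c0)//; congr (_ * _).
    by rewrite -(powR_inv1 (powR_ge0 c q)) -(powR_inv1 (ltW c0)) -!powRrM mulrC.
  rewrite !div_pow//.
  apply: (@le_trans _ _ ((a + b) `^ q *
      (t * (`|u i| / a) + (1 - t) * (`|v i| / b)) `^ q)).
    have m0 : 0 <= t * (`|u i| / a) + (1 - t) * (`|v i| / b).
      by move/andP: t01 => [t0 t1]; rewrite addr_ge0// mulr_ge0 ?subr_ge0// divr_ge0// ltW.
    rewrite -(powRM _ (ltW ab0) m0).
    have -> : (a + b) * (t * (`|u i| / a) + (1 - t) * (`|v i| / b)) = `|u i| + `|v i|.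
      by rewrite tE /t; field; rewrite !gt_eqF.
    apply: ge0_ler_powR; rewrite ?nnegrE ?addr_ge0 ?(ltW q0)//.
    exact: ler_normD.
  by rewrite ler_wpM2l ?powR_ge0//; apply: powR_convex => //; rewrite divr_ge0// ltW.
rewrite (le_trans (ler_sum _ (fun i _ => step i)))// -mulr_sumr.
rewrite -[leRHS]mulr1 ler_wpM2l ?powR_ge0// big_split/= -!mulr_sumr -!mulr_suml.
rewrite -[leRHS](subrK t) addrC.
move/andP: t01 => [t0 t1].
apply: lerD; rewrite -[leRHS]mulr1 ler_wpM2l ?subr_ge0//;
  by rewrite ler_pdivrMr ?powR_gt0// mul1r.
Qed.

Lemma lp_norm_triangle {R : realType} d (p : \bar R) (u v : 'I_d -> R) :
  (1%:E <= p)%E -> lp_norm p (fun i => u i + v i) <= lp_norm p u + lp_norm p v.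
Proof.
case: p => [q| |//]; last first.
  move=> _ /=; apply: bigmax_le => [|i _].
    by rewrite addr_ge0// bigmax_ge_id.
  by rewrite (le_trans (ler_normD _ _))// lerD// le_bigmax.
rewrite lee_fin /= => q1.
have q0 : 0 < q by rewrite (lt_le_trans ltr01).
have rootP s a : 0 <= s -> 0 <= a -> (s `^ q^-1 <= a) = (s <= a `^ q).
  move=> s0 a0; apply/idP/idP => sa.
    rewrite -[s]powRr1// -(mulVf (lt0r_neq0 q0)) powRrM.
    by apply: ge0_ler_powR; rewrite ?nnegrE ?powR_ge0// ltW.
  rewrite -[a]powRr1// -(mulfV (lt0r_neq0 q0)) powRrM.
  by apply: ge0_ler_powR; rewrite ?nnegrE ?powR_ge0// invr_ge0 ltW.
have S0 (w : 'I_d -> R) : 0 <= \sum_i `|w i| `^ q.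
  by apply: sumr_ge0 => i _; exact: powR_ge0.
have split_eps (a b e : R) : e + (a + b) = (a + e / 2) + (b + e / 2).
  by field.
(* Enlarging each norm by [e / 2] makes it positive, as [minkowski_sum] requires. *)
apply/ler_addgt0Pl => e e0; rewrite split_eps.
have e2 : 0 < e / 2 by rewrite divr_gt0.
have pos (a : R) : 0 <= a -> 0 < a + e / 2 by move=> a0; rewrite ltr_wpDl.
rewrite rootP//; last by rewrite addr_ge0// ltW// pos// powR_ge0.
apply: minkowski_sum => //; rewrite ?pos ?powR_ge0// -rootP ?S0//;
  by rewrite ?lerDl ltW// pos// powR_ge0.
Qed.

Lemma lp_dist_triangle {R : realType} d (p : \bar R) (x y z : d.-tuple R) :
  (1%:E <= p)%E -> lp_dist p x z <= lp_dist p x y + lp_dist p y z.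
Proof.
move=> p1; rewrite /lp_dist.
rewrite (_ : (fun i => _) = fun i => (tnth x i - tnth y i) + (tnth y i - tnth z i)).
  exact: lp_norm_triangle.
by apply/funext => i; rewrite addrA subrK.
Qed.

Lemma lp_distxx {R : realType} d (p : \bar R) (x : d.-tuple R) :
  (1%:E <= p)%E -> lp_dist p x x = 0.
Proof.
rewrite /lp_dist; case: p => [q| |//] /=; rewrite ?lee_fin => q1.
  have q0 : q != 0 by rewrite gt_eqF// (lt_le_trans ltr01).
  by rewrite big1 ?powR0 ?invr_eq0// => i _; rewrite subrr normr0 powR0.
by rewrite bigmax_eq_id// => i _; rewrite subrr normr0.
Qed.

Lemma measurable_lp_dist {R : realType} d (p : \bar R) (z : d.-tuple R) :
  measurable_fun [set: d.-tuple R] (fun x => lp_dist p x z).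
Proof.
rewrite /lp_dist.
have mi i : measurable_fun [set: d.-tuple R] (fun x => `|tnth x i - tnth z i|).
  apply: measurableT_comp => //; apply: measurable_funB => //.
  exact: measurable_tnth.
case: p => [q| |] /=; last exact: measurable_cst.
  apply: (measurableT_comp (measurable_powR q^-1)).
  by apply: measurable_sum => i; apply: (measurableT_comp (measurable_powR q)).
move: (index_enum _) => s; elim: s => [|i s IH].
  by under eq_fun do rewrite big_nil; exact: measurable_cst.
by under eq_fun do rewrite big_cons; exact: measurable_maxr.
Qed.

Lemma adv_lossE {R : realType} (X : Type) (U : X -> set X) (h : X -> bool)
    (x : X) (y : bool) :
  adv_loss U h x y = `[< exists2 z, U x z & h z != y >]%:R :> R.
Proof.
rewrite /adv_loss; set A := (X in sup X); case: asboolP => [[z Uz hz]|no].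
  apply/eqP; rewrite eq_le; apply/andP; split.
    apply: ge_sup; first by exists 1, z => //; rewrite hz.
    by move=> _ [w _ <-]; rewrite ler_nat leq_b1.
  apply: ub_le_sup; last by exists z => //; rewrite hz.
  by exists 1 => _ [w _ <-] /=; rewrite -[leRHS]/(1%:R) ler_nat leq_b1.
(* By convention [sup set0] is 0, so an empty perturbation set incurs no loss. *)
have [[x0 Ux0]|noU] := pselect (U x !=set0); last first.
  rewrite (_ : A = set0) ?sup0//; apply/seteqP; split => // r [w Uw _].
  by apply: noU; exists w.
rewrite (_ : A = [set 0]) ?sup1//; apply/seteqP; split => [_ [w Uw <-]|_ ->].
  by rewrite /= (_ : (_ != _) = false)//; apply: contra_notF no => hw; exists w.
exists x0 => //; rewrite (_ : (_ != _) = false)//.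
by apply: contra_notF no => hw; exists x0.
Qed.

(** The integral of a nonnegative function is a supremum over simple functions below it, hence
    monotone in any case. With arbitrary nearest neighbours the loss of the output may fail to be
    measurable. *)
Lemma ge0_le_integral_nonmeasurable {R : realType} d (T : measurableType d)
    (m : {measure set T -> \bar R}) (f g : T -> \bar R) :
  (forall x, 0 <= f x)%E -> (forall x, f x <= g x)%E ->
  (\int[m]_x f x <= \int[m]_x g x)%E.
Proof.
move=> f0 fg.
rewrite !ge0_integralTE//; last by move=> x; exact: le_trans (fg x).
by apply: le_ereal_sup => _ [h hf <-]; exists h => // x; exact: le_trans (fg x).
Qed.

Definition loss_set (X : Type) (U : X -> set X) (h : X -> bool) : set (X * bool) :=
  [set z | exists2 w, U z.1 w & h w != z.2].

Lemma adv_riskE {R : realType} {dX : measure_display} {X : measurableType dX}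
    (P : probability (X * bool)%type R) (U : X -> set X) (h : X -> bool) :
  measurable (loss_set U h) -> adv_risk P U h = P (loss_set U h).
Proof.
move=> mL; rewrite /adv_risk unlock -[in RHS](setIT (loss_set U h)) -integral_indic//.
by apply: eq_integral => z _; rewrite adv_lossE indicE; congr (_%:R%:E).
Qed.

Lemma le_adv_risk {R : realType} {dX : measure_display} {X : measurableType dX}
    (P : probability (X * bool)%type R) (U W : X -> set X) (f h : X -> bool) :
  loss_set U f `<=` loss_set W h -> (adv_risk P U f <= adv_risk P W h)%E.
Proof.
move=> UW; rewrite /adv_risk unlock; apply: ge0_le_integral_nonmeasurable => z.
  by rewrite adv_lossE lee_fin.
rewrite !adv_lossE lee_fin ler_nat; case: asboolP => // Uz.
by case: asboolP => // Wz; case: Wz; exact: UW.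
Qed.

Lemma loss_set_nn {R : realType} (X : Type) (dist : X -> X -> R) (rho eta : R)
    (C : set X) (f h : X -> bool) :
  (forall x y z, dist x z <= dist x y + dist y z) -> is_cover dist eta C ->
  (forall x, exists2 x', nearest dist C x x' & f x = h x') ->
  loss_set (dist_ball dist rho) f `<=`
  loss_set (fun x => dist_ball dist (rho + eta) x `&` C) h.
Proof.
move=> tri cov fh [x y] [z /= xz fy].
have [z' [Cz' nz'] fz] := fh z; exists z'; last by rewrite /= -fz.
split=> //; rewrite /dist_ball/= (le_trans (tri _ z _))// lerD//.
by have [c Cc zc] := cov z; exact: le_trans (nz' c Cc) zc.
Qed.

(** * Discretisation of the loss *)

Lemma measurable_to_nat d (T : measurableType d) (f : T -> nat) :
  (forall u, measurable (f @^-1` [set u])) -> measurable_fun [set: T] f.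
Proof.
move=> mf _ A _; rewrite setTI.
rewrite (_ : f @^-1` A = \bigcup_(u in A) (f @^-1` [set u])).
  by apply: bigcup_measurable => u _; exact: mf.
by apply/seteqP; split => [x Ax|x [u Au /= ->]//]; exists (f x).
Qed.

Section discretisation.
Context {dX : measure_display} {X : measurableType dX}.
Variables (W : X -> set X) (C : set X) (H : set (X -> bool)) (k v : nat).
Hypothesis cC : countable C.
Hypothesis mW : forall c, measurable [set x | W x c].
Hypothesis finWC : forall x, finite_set (W x `&` C).
Hypothesis cardWC : forall x, (#|` fset_set (W x `&` C)| <= k)%N.
Hypothesis vcH : forall K, shatters (fun x => [set x]) H K -> (#|` K| <= v)%N.

Let WC x := W x `&` C.

(* A labelled point [(x, y)] is encoded by the label [y] together with the
   finite set of the indices of [W x `&` C] in an enumeration of [C], so that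
   the encoding has countable range and still determines all the losses. *)
Lemma discretisation : exists (phi : X * bool -> nat) (E : (X -> bool) -> set nat),
  [/\ measurable_fun [set: X * bool] phi,
      forall h z, loss_set WC h z <-> E h (phi z) &
      forall l (s : l.-tuple nat),
        (#|trace [set E h | h in H] s| <= (l * k).+1 ^ v)%N].
Proof.
have /countable_injP[e ie] := cC.
pose N x : {fset nat} := fset_set (e @` WC x).
have NE x j : (j \in N x) = `[< exists2 c, WC x c & e c = j >].
  rewrite in_fset_set; last exact/finite_image/finWC.
  by apply/idP/asboolP => [/set_mem|/mem_set].
pose dec j := 'pinv_(fun=> point) C e j.
have decK c : C c -> dec (e c) = c.
  by move=> Cc; rewrite /dec pinvKV ?inE//.
have Nk x : (#|` N x| <= k)%N.
  rewrite (leq_trans _ (cardWC x))// /N fset_set_image; last exact: finWC.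
  exact: leq_imfset_card.
pose fib u : option ({fset nat} * bool) := choice.unpickle u.
pose phi (z : X * bool) : nat := choice.pickle (N z.1, z.2).
(* The bound on [#|F|] is automatic for codes of labelled points; it is imposed because the trace
   bound ranges over all natural numbers, including those that encode no point. *)
pose E h : set nat := [set u | exists F y, [/\ fib u = Some (F, y),
  (#|` F| <= k)%N & exists2 j, j \in F & h (dec j) != y]].
exists phi, E; split.
- apply: measurable_to_nat => u.
  case fu : (fib u) => [[F y]|]; last first.
    rewrite (_ : _ @^-1` _ = set0) //; apply/seteqP; split => // z /= zu.
    by move: fu; rewrite /fib -zu choice.pickleK.
  have [uE|uE] := eqVneq u (choice.pickle (F, y)); last first.
    rewrite (_ : _ @^-1` _ = set0) //; apply/seteqP; split => // z /= zu.
    move: fu; rewrite /fib -zu choice.pickleK => -[zF zy].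
    by move: uE; rewrite -zu /phi zF zy eqxx.
  rewrite (_ : _ @^-1` _ = [set x | N x = F] `*` [set y]); last first.
    apply/seteqP; split => [[x b] /= xu|[x b] [/= xF ->]].
      by move: fu; rewrite /fib -xu choice.pickleK => -[-> ->].
    by rewrite uE -xF.
  apply: measurableX => //.
  (* A finite set of indices is determined by countably many membership tests, and the test for [j]
     is [W x c] for the only [c] in [C] of index [j], if there is one. *)
  rewrite (_ : [set x | N x = F] =
      \bigcap_j [set x | (j \in N x) = (j \in F)]); last first.
    apply/seteqP; split => [x xF j _|x xF]; first by rewrite /= xF.
    by apply/fsetP => j; exact: (xF j).
  apply: bigcapT_measurable => j.
  have mj : measurable [set x | j \in N x].
    have [[c [Cc ej]]|nc] := pselect (exists c, C c /\ e c = j).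
      rewrite (_ : [set x | _] = [set x | W x c]) //.
      apply/seteqP; split => x /=; rewrite NE.
        move=> /asboolP[c' [Wc' Cc'] ec']; rewrite (ie c c') ?inE//.
        by rewrite ej ec'.
      by move=> Wc; apply/asboolP; exists c.
    rewrite (_ : [set x | _] = set0)//; apply/seteqP; split => // x /=.
    by rewrite NE => /asboolP[c [_ Cc] ec]; apply: nc; exists c.
  case: (j \in F).
    by [].
  rewrite (_ : [set x | _] = ~` [set x | j \in N x]); first exact: measurableC.
  by apply/seteqP; split => x /=; [move=> -> | move=> /negP/negbTE].
- move=> h [x y]; split.
    move=> [c WCc hc]; exists (N x), y; split => //.
      by rewrite /fib /phi choice.pickleK.
    exists (e c); first by rewrite NE; apply/asboolP; exists c.
    by rewrite decK//; case: WCc.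
  move=> [F [y' []]]; rewrite /fib /phi choice.pickleK => -[<- <-] _ [j].
  by rewrite NE => /asboolP[c WCc <-]; rewrite decK; [exists c|case: WCc].
- move=> l s.
  (* The sets [E h] consult [h] only at the decoded points of [s], at most [l * k] in number, so a
     trace is a function of the pattern of [h] on them. *)
  pose pts u : seq nat := if fib u is Some (F, _) then
    if (#|` F| <= k)%N then enum_fset F else [::] else [::].
  pose x := in_tuple (map dec (flatten [seq pts u | u <- s])).
  have szx : (size (map dec (flatten [seq pts u | u <- s])) <= l * k)%N.
    rewrite size_map.
    rewrite size_flatten /shape -map_comp -{2}(size_tuple s).
    elim: (tval s) => //= u t IH; rewrite mulSn leq_add// /pts.
    by case: (fib u) => [[F b]|]//; case: ifP.
  set m := size _ in x szx.
  pose Pat := [pred y : m.-tuple bool | `[< exists2 h, H h &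
      forall i z, [set tnth x i] z -> h z = tnth y i >]].
  have cardPat : (#|Pat| <= m.+1 ^ v)%N.
    exact: (@card_robust_patterns X (fun x => [set x]) H v m x (fun=> erefl) vcH).
  rewrite (@leq_trans #|Pat|)//; last first.
    rewrite (leq_trans cardPat)//; case: (v) => [|w]; first by rewrite !expn0.
    by rewrite leq_exp2r// ltnS.
  (* Reads the label of a point off the pattern at its first occurrence in [x]; the default [false]
     serves only points outside [x]. *)
  pose look (p : m.-tuple bool) z := nth false p (index z x).
  pose g (p : m.-tuple bool) : l.-tuple bool :=
    [tuple `[< E (look p) (tnth s i) >] | i < l].
  apply: leq_trans (leq_image_card g Pat).
  apply/subset_leq_card/fintype.subsetP => y /asboolP[_ [h Hh <-] hy].
  apply/fintype.imageP.
  exists [tuple h (tnth x i) | i < m].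
    by apply/asboolP; exists h => // i z ->; rewrite tnth_mktuple.
  apply: eq_from_tnth => i; rewrite hy tnth_mktuple; apply: asbool_equiv_eq.
  have lk F b j : fib (tnth s i) = Some (F, b) -> (#|` F| <= k)%N -> j \in F ->
      look [tuple h (tnth x i) | i < m] (dec j) = h (dec j).
    move=> Fi Fk jF.
    have jx : dec j \in x.
      rewrite memtE /=; apply/map_f/flattenP; exists (pts (tnth s i)).
        by apply/map_f/mem_tnth.
      by rewrite /pts Fi Fk.
    have im : (index (dec j) x < m)%N by rewrite -[X in (_ < X)%N](size_tuple x) index_mem.
    rewrite /look -[index _ _]/(val (Ordinal im)) -tnth_nth tnth_mktuple.
    by rewrite (tnth_nth (dec j)) /= nth_index.
  split=> -[F [b [Fi Fk [j jF hj]]]]; exists F, b; split => //; exists j => //.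
    by rewrite (lk F b).
  by rewrite -(lk F b).
Qed.

End discretisation.

(** * The two phases of the algorithm *)

Lemma bernoulli_ineq {R : realDomainType} (q : R) n :
  0 <= q <= 1 -> 1 - n%:R * q <= (1 - q) ^+ n.
Proof.
move=> /andP[q0 q1]; elim: n => [|n IH]; first by rewrite mul0r subr0 expr0.
rewrite exprS (@le_trans _ _ ((1 - q) * (1 - n%:R * q)))//; last first.
  by rewrite ler_wpM2l// subr_ge0.
have : 0 <= n%:R * q * q by rewrite !mulr_ge0.
by rewrite -[n.+1%:R]natr1; lra.
Qed.

Lemma tnth_zip_pair (S T : Type) n (s : n.-tuple S) (t : n.-tuple T) i :
  tnth [tuple of zip s t] i = (tnth s i, tnth t i).
Proof.
have x : S := tnth s i; have y : T := tnth t i.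
by rewrite !(tnth_nth (x, y)) (tnth_nth x) (tnth_nth y) /= nth_zip// !size_tuple.
Qed.

(** Conditioning on the second factor, which will be the unlabelled sample; uniqueness of the
    product measure makes that factor the outer variable of integration. *)
Lemma product_section_bound {R : realType} d1 d2 (T1 : measurableType d1)
    (T2 : measurableType d2) (P1 : probability T1 R) (P2 : probability T2 R)
    (S : set (T1 * T2)) (G : set T2) (a b : R) :
  measurable S -> measurable G -> 0 <= a -> (b%:E <= P2 G)%E ->
  (forall y, G y -> a%:E <= P1 (ysection S y))%E ->
  ((a * b)%:E <= (P1 \x P2) S)%E.
Proof.
move=> mS mG a0 bG aS.
rewrite (@product_measure_unique _ _ _ _ _ P1 P2 (P1 \x^ P2)%E)//; last first.
  by move=> A B mA mB; exact: product_measure2E.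
apply: (@le_trans _ _ (a%:E * P2 G)%E); first by rewrite EFinM lee_wpmul2l.
have -> : (a%:E * P2 G = \int[P2]_y (a * \1_G y)%:E)%E.
  under eq_integral do rewrite EFinM.
  rewrite ge0_integralZl_EFin//; last exact/measurable_EFinP/measurable_indic.
  by rewrite integral_indic// setIT.
apply: ge0_le_integral => //.
- by move=> y _; rewrite lee_fin mulr_ge0.
- by apply/measurable_EFinP/measurable_funM => //; exact: measurable_indic.
- exact: measurable_fun_ysection.
- move=> y _; rewrite indicE.
  have [/set_mem/aS|_] := boolP (y \in G); first by rewrite mulr1.
  by rewrite mulr0 measure_ge0.
Qed.

Section phases.
Context {R : realType} {dX : measure_display} {X : measurableType dX}.
Variable P : probability (X * bool)%type R.
Variable phi : {mfun (X * bool)%type >-> nat}.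
Local Notation Q := (distribution P phi).

(** An unlabelled sample is a labelled one with its labels erased. The erased labels witness
    membership in [G] unless the sample meets [L0] (cost [d1]) or its code misses a heavy set of the
    class (cost [d2]). *)
Lemma unlabelled_phase (cls : set (set nat)) (L0 : set (X * bool))
    (e d1 d2 q : R) (n N k : nat) :
  measurable L0 -> P L0 = q%:E -> n%:R * q <= d1 ->
  k%:R <= e * n%:R / 4 -> 4 <= e * n%:R -> (k <= n)%N ->
  (forall s : (n + n).-tuple nat, #|trace cls s| <= N)%N ->
  2 * N%:R / 2 ^+ k <= d2 ->
  exists G : set (n.-tuple X),
    [/\ measurable G, ((1 - d1 - d2)%:E <= iid (marginal P) n G)%E &
     forall Su, G Su -> exists y : n.-tuple bool,
       (forall i, ~ L0 (tnth Su i, tnth y i)) /\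
       forall E, cls E -> (forall i, ~ E (phi (tnth Su i, tnth y i))) ->
         (Q E <= e%:E)%E].
Proof.
move=> mL PL nq ke en kn trN Nd.
pose M : set (n.-tuple nat) := missed_heavy Q cls e.
pose zp (y : n.-tuple bool) (Su : n.-tuple X) : n.-tuple nat :=
  [tuple phi (tnth Su i, tnth y i) | i < n].
pose Gy y : set (n.-tuple X) :=
  [set Su | (forall i, ~ L0 (tnth Su i, tnth y i))] `&` (zp y @^-1` ~` M).
(* The true labels are unknown, so [G] asks for some suitable labelling; there are finitely many,
   which keeps [G] measurable. *)
pose G := \bigcup_y Gy y.
have mpair (b : bool) : measurable_fun [set: X] (fun x => (x, b)).
  by apply: measurable_fun_pair.
have mzp y : measurable_fun [set: n.-tuple X] (zp y).
  apply/measurable_fun_tnthP => i.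
  rewrite (_ : _ \o _ = phi \o (fun x => (x, tnth y i)) \o (fun Su => tnth Su i)).
    apply: measurableT_comp; last exact: measurable_tnth.
    by apply: measurableT_comp.
  by apply/funext => Su /=; rewrite tnth_mktuple.
have mG : measurable G.
  apply: countable_bigcupT_measurable => [|y]; first exact: countableP.
  apply: measurableI; last first.
    rewrite -[X in measurable X]setTI; apply: mzp => //.
    exact: measurable_nat_tuple.
  apply: (measurable_forall_tnth (A := fun i => (fun x => (x, tnth y i)) @^-1` ~` L0)).
  move=> i; rewrite -[X in measurable X]setTI; apply: mpair => //.
  exact: measurableC.
exists G; split => //; last first.
  move=> Su [y _ [L0y nM]]; exists y; split => // E clsE miss.
  rewrite leNgt; apply/negP => eE; apply: nM; exists E => // i.
  by rewrite /zp tnth_mktuple.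
rewrite /marginal iid_distribution//.
pose A : set (n.-tuple (X * bool)) := [set S | forall i, (~` L0) (tnth S i)].
pose B : set (n.-tuple (X * bool)) := [set S | M (map_tuple phi S)].
have mA : measurable A.
  by apply: (measurable_forall_tnth (A := fun=> ~` L0)) => i; exact: measurableC.
have mmap : measurable_fun [set: n.-tuple (X * bool)] (map_tuple phi).
  exact: measurable_map_tuple.
have mB : measurable B.
  by rewrite -[B]setTI; apply: mmap => //; exact: measurable_nat_tuple.
have q01 : 0 <= q <= 1.
  by rewrite -!lee_fin -PL measure_ge0 probability_le1.
have PA : (iid P n A = ((1 - q) ^+ n)%:E)%E.
  have -> : (iid P n A = \prod_(i < n) (1 - q)%:E)%E.
    rewrite EFinB -PL -(probability_setC P mL).
    by apply: (iid_rect P (A := fun=> ~` L0)) => i; exact: measurableC.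
  by rewrite prodEFin prodr_const card_ord.
have PB : (iid P n B <= d2%:E)%E.
  have <- : (iid Q n M = iid P n B)%E.
    by apply: iid_distribution; exact: measurable_nat_tuple.
  apply: (le_trans (missed_heavy_bound Q ke en kn trN)); by rewrite lee_fin.
apply: (@le_trans _ _ (iid P n (A `\` B))).
  apply: (@le_trans _ _ (iid P n A - iid P n B)%E).
    rewrite !EFinB; apply: leeB => //.
    by rewrite PA lee_fin (le_trans _ (bernoulli_ineq n q01))// lerB.
  rewrite leeBlDr//; last by apply: fin_num_measure.
  have : (iid P n A <= iid P n ((A `\` B) `|` B))%E.
    apply: le_measure; rewrite ?inE//.
      by apply: measurableU => //; exact: measurableD.
    by move=> S AS; have [BS|BS] := pselect (B S); [right|left].
  move=> /le_trans; apply; apply: measureU2 => //; exact: measurableD.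
apply: le_measure; rewrite ?inE//; first exact: measurableD.
  rewrite -[X in measurable X]setTI.
  suff mf : measurable_fun [set: n.-tuple (X * bool)] (map_tuple fst_rv).
    exact: mf.
  exact: measurable_map_tuple.
move=> S [AS BS]; exists (map_tuple snd S) => //.
have Si i : (tnth (map_tuple fst_rv S) i, tnth (map_tuple snd S) i) = tnth S i.
  by rewrite !tnth_map /fst_rv -surjective_pairing.
split=> [i|]; first by rewrite Si; exact: AS.
rewrite /preimage/= (_ : zp _ _ = map_tuple phi S)//.
by apply: eq_from_tnth => i; rewrite tnth_mktuple Si tnth_map.
Qed.

(** The threshold [e * m / 4] separates the two cases: a set of mass at most [e / 16] rarely hits
    that often, and one of mass above [e] rarely hits so seldom. A union bound over [Y], plus one
    event for [i0], concludes. *)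
Lemma finite_class_erm (m : nat) (I : finType) (Y : pred I) (E : I -> set nat)
    (i0 : I) (e : R) :
  (Q (E i0) <= (e / 16)%:E)%E ->
  (iid Q m [set s | ~ forall i, Y i -> (hits (E i) s <= hits (E i0) s)%N ->
      (Q (E i) <= e%:E)%E] <=
   ((#|Y|.+1)%:R * expR (- (e * m%:R / 16)))%:E)%E.
Proof.
have quarter (t : R) : 0 <= t -> - (t / 4) <= - (t / 16) by move=> t0; lra.
move=> Qi0.
have QE F : Q F = (fine (Q F))%:E by rewrite fineK// fin_num_measure.
have e0 : 0 <= e.
  have : (0 <= (e / 16)%:E)%E by exact: le_trans Qi0.
  by rewrite lee_fin pmulr_lge0.
pose B0 := [set s : m.-tuple nat | e * m%:R / 4 <= (hits (E i0) s)%:R].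
pose Bi i := [set s : m.-tuple nat | (e%:E < Q (E i))%E /\
  (hits (E i) s)%:R <= e * m%:R / 4].
apply: (@le_trans _ _ (iid Q m (B0 `|` \big[setU/set0]_(i | Y i) Bi i))).
  apply: le_measure; rewrite ?inE; try exact: measurable_nat_tuple.
  move=> s /existsNP[i /not_implyP[Yi /not_implyP[hi /negP]]].
  rewrite -ltNge => eQ.
  have [h|h] := leP (e * m%:R / 4) (hits (E i0) s)%:R; first by left.
  right; rewrite -bigcup_seq_cond; exists i => /=; first by rewrite mem_index_enum.
  by split=> //; rewrite (le_trans _ (ltW h))// ler_nat.
apply: (@le_trans _ _ (iid Q m B0 + \sum_(i | Y i) iid Q m (Bi i))%E).
  apply: (@le_trans _ _ (iid Q m B0 + iid Q m (\big[setU/set0]_(i | Y i) Bi i))%E).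
    by apply: measureU2; exact: measurable_nat_tuple.
  apply: leeD => //.
  apply: (big_ind2 (fun B r => (iid Q m B <= r)%E)) => [|A a B b Aa Bb|//].
    by rewrite measure0.
  apply: (@le_trans _ _ (iid Q m A + iid Q m B)%E); last exact: leeD.
  by apply: measureU2; exact: measurable_nat_tuple.
rewrite -[(#|Y|.+1)%:R]nat1r mulrDl mul1r EFinD; apply: leeD.
  apply: (many_hits_tail _ (QE (E i0))) => //.
  - by rewrite -lee_fin -QE.
  - exact: measurable_nat_tuple.
rewrite mulr_natl -sumr_const -sumEFin; apply: lee_sum => i Yi.
(* The event [Bi i] is empty unless [E i] is heavy. *)
have [eQ|eQ] := pselect (e%:E < Q (E i))%E; last first.
  rewrite (_ : Bi i = set0) ?measure0 ?lee_fin ?expR_ge0//.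
  by apply/seteqP; split => // s [].
apply: (@le_trans _ _ (expR (- (e * m%:R / 4)))%:E).
  apply: (few_hits_tail _ (QE (E i))) => //.
  - by rewrite -lee_fin -QE ltW.
  - exact: measurable_nat_tuple.
  - by move=> s [].
by rewrite lee_fin ler_expR quarter// mulr_ge0.
Qed.

End phases.

(** * Empirical risks as hit counts *)

Section empirical_risk.
Context {R : realType} {dX : measure_display} {X : measurableType dX}.
Implicit Types (U : X -> set X) (h : X -> bool).

Lemma emp_riskE U h n (S : n.-tuple (X * bool)) :
  emp_risk U h S = n%:R^-1 * (hits (loss_set U h) S)%:R :> R.
Proof.
rewrite /emp_risk /hits -sum1_card natr_sum [in RHS]big_mkcond/=; congr (_ * _).
apply: eq_bigr => i _; rewrite adv_lossE inE.
by case: asboolP.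
Qed.

Lemma emp_risk_ge0 U h n (S : n.-tuple (X * bool)) : 0 <= emp_risk U h S :> R.
Proof. by rewrite emp_riskE mulr_ge0. Qed.

Lemma emp_risk_eq0P U h n (S : n.-tuple (X * bool)) : (0 < n)%N ->
  emp_risk U h S = 0 :> R <-> forall i, ~ loss_set U h (tnth S i).
Proof.
move=> n0; rewrite emp_riskE; split=> [/eqP|nS].
  rewrite mulf_eq0 invr_eq0 !pnatr_eq0 gtn_eqF//= => /eqP/card0_eq S0 i Li.
  by have := S0 i; rewrite !inE => /asboolP.
by rewrite (_ : hits _ _ = 0%N) ?mulr0//; apply: eq_card0 => i; apply/asboolP/nS.
Qed.

Lemma emp_risk_le_hits U h h' n (S : n.-tuple (X * bool)) :
  emp_risk U h S <= emp_risk U h' S :> R ->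
  (hits (loss_set U h) S <= hits (loss_set U h') S)%N.
Proof.
(* On the empty sample all empirical risks are 0, and so are all hit counts. *)
case: n S => [|n] S; first by rewrite /hits eq_card0// => -[].
by rewrite !emp_riskE ler_pM2l ?invr_gt0// ler_nat.
Qed.

End empirical_risk.

(** * Success of the algorithm for a general distance *)

Section semi_supervised.
Context {R : realType} {dX : measure_display} {X : measurableType dX}.
Variables (dist : X -> X -> R) (r eta : R) (H : set (X -> bool)) (C : set X).
Hypothesis dist_tri : forall x y z, dist x z <= dist x y + dist y z.
Hypothesis distxx : forall x, dist x x = 0.
Hypothesis mdist : forall z, measurable_fun [set: X] (fun x => dist x z).
Hypothesis r0 : 0 < r.
Hypothesis eta0 : 0 < eta.
Let U := dist_ball dist r.
Let V := dist_ball dist (r + eta).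
Variables (k v w : nat).
Hypothesis hypH : hypothesis_class R V H.
Hypothesis cC : countable C.
Hypothesis coverC : is_cover dist eta C.
Hypothesis finVC : forall x, finite_set (V x `&` C).
Hypothesis cardVC : forall x, (#|` fset_set (V x `&` C)| <= k)%N.
Hypothesis vcH : forall K, shatters (fun x => [set x]) H K -> (#|` K| <= v)%N.
Hypothesis vcVH : forall K, shatters V H K -> (#|` K| <= w)%N.
Variables (A : oracle X) (alg : ss_learner X).
Hypothesis rermA : rerm R V H A.
Hypothesis algP : ss_algorithm dist V C A alg.
Variable P : probability (X * bool)%type R.
Hypothesis riskP : class_adv_risk P V H = 0%E.

Let VC x := V x `&` C.

Lemma V_refl x : V x x.
Proof. by rewrite /V /dist_ball/= distxx addr_ge0// ltW. Qed.

(** The infimum 0 of the risks need not be attained, so only hypotheses of arbitrarily small risk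
    are available. *)
Lemma consistent_hypothesis (a : R) : 0 < a -> exists h q,
  [/\ H h, measurable (loss_set V h), P (loss_set V h) = q%:E & q <= a].
Proof.
move=> a0.
have : (class_adv_risk P V H < a%:E)%E by rewrite riskP lte_fin.
move=> /ereal_inf_lt[_ [h Hh <-]] ha.
have mL : measurable (loss_set V h).
  have [_ /(_ h Hh)[_]] := hypH; congr (measurable _).
  apply/seteqP; split => -[x y] /=; rewrite adv_lossE; case: asboolP => //.
  by move=> _ /esym/eqP; rewrite oner_eq0.
exists h, (fine (P (loss_set V h))); split => //.
  by rewrite fineK// fin_num_measure.
by rewrite -lee_fin fineK ?fin_num_measure// -adv_riskE// ltW.
Qed.

(** Zero [V]-loss on a labelled sample means that the hypothesis takes the prescribed label on the
    whole of each [V]-ball, which is the robust pattern counted by Sauer's lemma. *)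
Lemma card_consistent_labellings n (Su : n.-tuple X) : (0 < n)%N ->
  (#|[pred y : n.-tuple bool | `[< emp_risk V (A [tuple of zip Su y])
     [tuple of zip Su y] = 0%R :> R >]]| <= n.+1 ^ w)%N.
Proof.
move=> n0; apply: leq_trans (card_robust_patterns Su V_refl vcVH).
apply/subset_leq_card/fintype.subsetP => y /asboolP/(emp_risk_eq0P _ _ _ n0) Ay.
apply/asboolP; exists (A [tuple of zip Su y]).
  by have [] := rermA [tuple of zip Su y].
move=> i z Vz; apply/eqP/negP => /negP hz; apply: (Ay i).
by rewrite tnth_zip_pair; exists z.
Qed.

Lemma semi_supervised_success (eps delta : R) (n m k0 : nat) :
  0 < eps -> 0 < delta < 1 ->
  k0%:R <= eps / 16 * n%:R / 4 -> 4 <= eps / 16 * n%:R -> (k0 <= n)%N ->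
  2 * (((n + n) * k).+1 ^ v)%:R / 2 ^+ k0 <= delta / 4 ->
  ((n.+1 ^ w).+1)%:R * expR (- (eps * m%:R / 16)) <= delta / 2 ->
  let success := [set S : m.-tuple (X * bool) * n.-tuple X |
     (adv_risk P U (alg S.1 S.2) <= eps%:E)%E] in
  measurable success ->
  ((1 - delta)%:E <= (iid P m \x iid (marginal P) n) success)%E.
Proof.
move=> eps0 /andP[delta0 delta1] kn en k0n Ndelta Mdelta success msuccess.
have n0 : (0 < n)%N.
  by case: n en {kn k0n Ndelta Mdelta success msuccess} => //; rewrite mulr0; lra.
have mV c : measurable [set x | V x c].
  rewrite (_ : [set x | _] = (fun x => dist x c) @^-1` `]-oo, (r + eta)]).
    by rewrite -[X in measurable X]setTI; exact: mdist.
  by apply/seteqP; split => x; rewrite /= in_itv.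
have [phi0 [E [mphi lossE traceE]]] := discretisation cC mV finVC cardVC vcH.
have mEh h : measurable (phi0 @^-1` E h).
  by rewrite -[X in measurable X]setTI; apply: mphi.
pose mphi_mixin := isMeasurableFun.Build _ _ _ _ phi0 mphi.
pose phi : {mfun (X * bool)%type >-> nat} := HB.pack phi0 mphi_mixin.
pose Q := distribution P phi.
(* With risk at most [delta / (4 * n)], [h0] incurs a loss somewhere on [n] draws with probability
   at most [delta / 4]. *)
have [h0 [q [Hh0 mL0 PL0 q_small]]] :=
  @consistent_hypothesis (delta / 4 / n%:R) ltac:(by rewrite !divr_gt0// ltr0n).
have nq : n%:R * q <= delta / 4 by rewrite mulrC -ler_pdivlMr// ltr0n.
have [G [mG PG GP]] := @unlabelled_phase _ _ _ P phi [set E h | h in H] _ _ _ _ _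
  n _ k0 mL0 PL0 nq kn en k0n (traceE _) Ndelta.
have half0 : 0 <= 1 - delta / 2 by lra.
(* The unlabelled phase may fail with probability [delta / 4 + delta / 4], the labelled one with
   [delta / 2]; and [(1 - delta / 2) ^ 2 >= 1 - delta]. *)
apply: (@le_trans _ _ ((1 - delta / 2) * (1 - delta / 4 - delta / 4))%:E).
  rewrite lee_fin; have : 0 <= delta * delta by rewrite mulr_ge0// ltW.
  by lra.
apply: (product_section_bound msuccess mG) => // Su GSu.
have [y [h0y lowrisk]] := GP Su GSu.
pose Y := [pred y : n.-tuple bool | `[< emp_risk V (A [tuple of zip Su y])
  [tuple of zip Su y] = 0 :> R >]].
pose hyp (y : n.-tuple bool) := A [tuple of zip Su y].
have Hhyp y' : H (hyp y') by have [] := rermA [tuple of zip Su y'].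
(* Since [h0] has no loss on this labelling, the minimal empirical risk is 0 and the oracle attains
   it. *)
have Yy : Y y.
  apply/asboolP; apply/eqP; rewrite eq_le emp_risk_ge0 andbT.
  have [_ /(_ h0 Hh0)] := rermA [tuple of zip Su y].
  move=> /le_trans; apply; rewrite le_eqVlt; apply/orP; left; apply/eqP.
  by apply/emp_risk_eq0P => // i; rewrite tnth_zip_pair; exact: h0y.
have Ylow : (Q (E (hyp y)) <= (eps / 16)%:E)%E.
  apply: lowrisk; first by exists (hyp y).
  move=> i Ei; move/asboolP : Yy => /(emp_risk_eq0P _ _ _ n0)/(_ i); apply.
  rewrite tnth_zip_pair; have [c [Vc Cc] hc] := (lossE _ _).2 Ei.
  by exists c.
(* Given [Su], the candidates form a finite class indexed by labellings, with that of [y] as the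
   reference of small risk. *)
have := @finite_class_erm _ _ _ P phi m _ Y (E \o hyp) y eps Ylow.
set Bad := [set s | _] => PBad.
have mBad : measurable Bad by exact: measurable_nat_tuple.
apply: (@le_trans _ _ (iid Q m (~` Bad))).
  rewrite probability_setC// EFinB leeB//; apply: (le_trans PBad).
  rewrite lee_fin (le_trans _ Mdelta)// ler_wpM2r ?expR_ge0// ler_nat ltnS.
  exact: card_consistent_labellings.
rewrite /Q iid_distribution; last exact: measurableC.
have mmap : measurable_fun [set: m.-tuple (X * bool)] (map_tuple phi).
  exact: measurable_map_tuple.
apply: le_measure; rewrite ?inE.
- rewrite -[X in measurable X]setTI; apply: mmap => //; exact: measurableC.
- exact: measurable_ysection.
move=> Sl nBad; apply/ysectionP; rewrite /success /=.
have {}nBad := contrapT nBad.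
have cand0 : candidates R V A Su !=set0.
  by exists (hyp y), y => //; exact/asboolP.
have [h [[y' hE hy'] hmin] nnh] := algP Sl cand0.
have hitsE h' : hits (E h') (map_tuple phi Sl) = hits (loss_set VC h') Sl.
  apply: eq_card => i; rewrite !inE tnth_map; apply: asbool_equiv_eq.
  by split => /lossE.
have Qh : (Q (E h) <= eps%:E)%E.
  rewrite hE; apply: (nBad y'); first by apply/asboolP; rewrite -/(hyp _) /hyp -hE.
  rewrite /= !hitsE; apply: (@emp_risk_le_hits R).
  by rewrite /hyp -hE; apply: hmin; exists y => //; exact/asboolP.
have lossEh : loss_set VC h = phi @^-1` E h.
  by apply/seteqP; split => z /lossE.
apply: (@le_trans _ _ (adv_risk P VC h)).
  apply: le_adv_risk; exact: (loss_set_nn dist_tri coverC nnh).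
by rewrite adv_riskE lossEh//; exact: mEh.
Qed.

End semi_supervised.

(** * Dimensions and the choice of the sample sizes *)

(** A nonempty class shatters the empty set, so its dimension is not [-oo], and a finite dimension
    can be truncated to a natural bound. *)
Lemma robust_vc_dim_fine {R : realType} (X : choiceType) (V : X -> set X)
    (H : set (X -> bool)) : H !=set0 -> (robust_vc_dim R V H < +oo)%E ->
  0 <= fine (robust_vc_dim R V H) /\
  forall K, shatters V H K ->
    (#|` K| <= Num.truncn (fine (robust_vc_dim R V H)))%N.
Proof.
move=> [h Hh] fin.
have ub K : shatters V H K -> ((#|` K|%:R)%:E <= robust_vc_dim R V H)%E.
  by move=> sK; apply: ereal_sup_ubound; exists K.
have dim0 : (0 <= robust_vc_dim R V H)%E.
  rewrite (le_trans _ (ub fset0 _)) ?lee_fin// => y.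
  by exists h => // x; rewrite inE.
have a0 : 0 <= fine (robust_vc_dim R V H) by exact: fine_ge0.
split=> // K /ub; rewrite -[X in (_ <= X)%E -> _]fineK ?ge0_fin_numE//.
by rewrite lee_fin truncn_ge_nat.
Qed.

Lemma robust_vc_dim_le {R : realType} (X : choiceType) (V : X -> set X)
    (H : set (X -> bool)) : (forall x, V x x) ->
  (robust_vc_dim R V H <= vc_dim R H)%E.
Proof.
move=> Vxx; apply: le_ereal_sup => _ [K sK <-]; exists K => // y.
have [h Hh hy] := sK y; exists h => // x Kx _ ->.
by apply: hy.
Qed.

Theorem theorem14 (R : realType) :
  exists2 c : R, 0 < c &
  forall (d : nat) (p : \bar R) (r gamma : R)
         (H : set (d.-tuple R -> bool)) (C : set (d.-tuple R)),
  (0 < d)%N -> (1%:E <= p)%E -> 0 < r -> 0 < gamma ->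
  let dist := @lp_dist R d p in
  let U := dist_ball dist r in
  let V := dist_ball dist ((1 + gamma) * r) in
  hypothesis_class R V H ->
  (vc_dim R H < +oo)%E ->
  countable C ->
  is_cover dist (r * gamma) C ->
  (forall x, finite_set (V x `&` C) /\
     #|` fset_set (V x `&` C)|%:R
       <= (1 + (1 + gamma) * d%:R / gamma) ^+ d :> R) ->
  let vc := fine (vc_dim R H) in
  let vcV := fine (robust_vc_dim R V H) in
  exists mu ml : R -> R -> nat,
    (forall eps delta : R, 0 < eps < 1 -> 0 < delta < 1 ->
       soft_bigO c
         ((vc * d%:R * (log1 (1 + gamma^-1) + log1 d%:R) + log1 delta^-1) / eps)
         [:: vc; d%:R; gamma^-1; delta^-1; eps^-1]
         (mu eps delta) /\
       soft_bigO c
         ((vcV * log1 (mu eps delta)%:R + log1 delta^-1) / eps ^+ 2)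
         [:: vcV; (mu eps delta)%:R; delta^-1; eps^-1]
         (ml eps delta)) /\
    forall (A : oracle (d.-tuple R)) (alg : ss_learner (d.-tuple R)),
      rerm R V H A ->
      ss_algorithm dist V C A alg ->
      tolerant_robust_ss_learner U V H alg mu ml.
Proof.
(* Twice the constant [32 * 64] of [unlabelled_size]; the doubling pays for rounding the sample size
   up. *)
exists (64 * 64); first by rewrite mulr_gt0.
move=> d p r gamma H C d0 p1 r0 gamma0 dist U V hypH vcfin cC cov.
move=> multC vc vcV.
(* The tolerant radius is the radius of [U] plus that of the cover. *)
have VE : (1 + gamma) * r = r + r * gamma by rewrite mulrDl mul1r mulrC.
have Vxx x : V x x.
  by rewrite /V /dist_ball/= /dist lp_distxx// mulr_ge0 ?addr_ge0 ?ltW.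
have [H0 _] := hypH.
have [vc0 vcK] := robust_vc_dim_fine H0 vcfin.
have [vcV0 vcVK] := robust_vc_dim_fine H0 (le_lt_trans (@robust_vc_dim_le R _ V H Vxx) vcfin).
rewrite -/(vc_dim R H) -/vc in vc0 vcK; rewrite -/vcV in vcV0 vcVK.
pose D := d%:R * (log1 (1 + gamma^-1) + log1 d%:R) : R.
have D2 : 2 <= D.
  have h1 := log1_ge1 (1 + gamma^-1); have h2 := log1_ge1 (d%:R : R).
  have : 1 * 2 <= D by rewrite ler_pM ?ler1n//; lra.
  by rewrite mul1r.
pose gu (eps delta : R) := (vc * D + log1 delta^-1) / eps.
pose qu (eps delta : R) := [:: vc; d%:R; gamma^-1; delta^-1; eps^-1].
pose L eps delta : R := log1 (\big[Num.max/0]_(q <- qu eps delta) q).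
pose mu eps delta := (Num.truncn (32 * 64 * gu eps delta * L eps delta)).+1.
pose gl (eps delta : R) :=
  (vcV * log1 (mu eps delta)%:R + log1 delta^-1) / eps ^+ 2.
(* The constant 64 is that of [labelled_size]; [log1] of [mu] is already fixed, so no circularity
   arises here. *)
pose ml eps delta := (Num.truncn (64 * gl eps delta)).+1.
have gu1 eps delta : 0 < eps < 1 -> 1 <= gu eps delta.
  move=> /andP[eps0 eps1]; rewrite ler_pdivlMr// mul1r.
  have := log1_ge1 delta^-1; have : 0 <= vc * D by rewrite mulr_ge0//; lra.
  by lra.
have gl1 eps delta : 0 < eps < 1 -> 1 <= gl eps delta.
  move=> /andP[eps0 eps1]; rewrite ler_pdivlMr ?exprn_gt0// mul1r.
  have := log1_ge1 delta^-1; have := log1_ge1 ((mu eps delta)%:R : R) => m1 l1.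
  have : 0 <= vcV * log1 (mu eps delta)%:R by rewrite mulr_ge0//; lra.
  have : eps ^+ 2 <= 1 by rewrite expr_le1 ?ltW.
  by lra.
have muP eps delta : 0 < eps < 1 ->
    32 * 64 * gu eps delta * L eps delta <= (mu eps delta)%:R <=
    64 * 64 * gu eps delta * L eps delta.
  move=> e01; have g1 := gu1 eps delta e01.
  have gL : 1 * 1 <= gu eps delta * L eps delta by rewrite ler_pM ?log1_ge1.
  have {}gL : 1 <= gu eps delta * L eps delta by rewrite -[leLHS]mulr1.
  rewrite (ltW (truncnS_gt _)) andTb /mu -[leLHS]natr1.
  have : (Num.truncn (32 * 64 * gu eps delta * L eps delta))%:R <=
      32 * 64 * gu eps delta * L eps delta by rewrite truncn_le; lra.
  by lra.
exists mu, ml; split=> [eps delta e01 d01|A alg rermA algP eps delta e01 d01].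
  have g1 := gu1 eps delta e01; have gl1' := gl1 eps delta e01; split.
    have -> : vc * d%:R * (log1 (1 + gamma^-1) + log1 d%:R) = vc * D.
      by rewrite mulrA.
    apply: soft_bigO_log1; first (by lra); first by rewrite (le_trans _ g1).
    by have /andP[] := muP eps delta e01.
  apply: soft_bigO_log1; first (by lra); first by rewrite (le_trans _ gl1').
  rewrite -/(gl eps delta); set L' := log1 _.
  have L1 : 1 <= L' by exact: log1_ge1.
  have gL : gl eps delta * 1 <= gl eps delta * L' by rewrite ler_wpM2l//; lra.
  rewrite /ml -[leLHS]natr1.
  have : (Num.truncn (64 * gl eps delta))%:R <= 64 * gl eps delta.
    by rewrite truncn_le; lra.
  by lra.
move=> P riskP.
have [/andP[eps0 eps1] /andP[del0 del1]] := (e01, d01).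
have /andP[mu_lo mu_hi] := muP eps delta e01.
set n := mu eps delta in mu_lo mu_hi *.
pose k := Num.truncn ((1 + (1 + gamma) * d%:R / gamma) ^+ d : R).
have base0 : 0 <= (1 + (1 + gamma) * d%:R / gamma) ^+ d :> R.
  by rewrite exprn_ge0// addr_ge0// divr_ge0 ?mulr_ge0 ?addr_ge0 ?(ltW gamma0).
have kD : k%:R <= expR (2 * D) :> R.
  by rewrite (le_trans _ (cover_multiplicity d0 gamma0))// /k truncn_le.
have Qmax q : q \in qu eps delta ->
    q <= \big[Num.max/0]_(q <- qu eps delta) q.
  by move=> qq; exact: (@Order.TotalTheory.le_bigmax_seq _ R R (qu eps delta) 0 q xpredT id).
(* The upper bound on [n] makes [ln n] comparable with [L], closing the loop in the choice of
   [mu]. *)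
have nL : n%:R <= expR (12 + 7 * L eps delta).
  apply: (unlabelled_size_log (a := vc) (gamma := gamma) (eps := eps)
    (delta := delta) (d := d)) => //;
  by apply: Qmax; rewrite /qu !inE eqxx ?orbT.
have lo : 32 * 64 * (vc * D + log1 delta^-1) * L eps delta <= eps * n%:R.
  rewrite [leRHS]mulrC -ler_pdivrMr//.
  by rewrite (le_trans _ mu_lo)// /gu mulrAC !mulrA.
have vcle : (Num.truncn vc)%:R <= vc by rewrite truncn_le.
have [kn en k0n Ndelta] := unlabelled_size e01 del0 vcle D2 (log1_ge1 _) (log1_ge1 _)
  (ln_le_log1 _) kD nL lo.
have Mdelta : ((n.+1 ^ Num.truncn vcV).+1)%:R *
    expR (- (eps * (ml eps delta)%:R / 16)) <= delta / 2.
  apply: (labelled_size (a := vcV) (ld := log1 delta^-1) (lg := log1 n%:R)) => //.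
  - by rewrite truncn_le.
  - exact: log1_ge1.
  - exact: ln_le_log1.
  - exact: ln_le_log1.
  - exact: log1_ge1.
  - by rewrite -mulrA; exact/ltW/truncnS_gt.
apply: (semi_supervised_success (dist := dist) (r := r) (eta := r * gamma)
  (H := H) (C := C) (k := k) (v := Num.truncn vc) (w := Num.truncn vcV) (A := A)
  _ _ _ _ _ _ _ _ _ _ _ _ _ _ _ eps0 d01 kn en k0n Ndelta Mdelta) => //;
  rewrite -?VE//.
- by move=> x y z; exact: lp_dist_triangle.
- by move=> x; exact: lp_distxx.
- by move=> z; exact: measurable_lp_dist.
- by rewrite mulr_gt0.
- by move=> x; have [] := multC x.
- by move=> x; have [_ h] := multC x; rewrite truncn_ge_nat.
Qed.
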